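(* Let $\varepsilon>0$, $f\in\mathbb R[x]_{2d}$ and $g_i\in\mathbb R[x]_{2d_i}$ for $i=0,\dots,m$, with $g_0=1$, and let $k\ge\max\{d,d_0,\dots,d_m\}$. Let $S(g)=\{x\in\mathbb R^n: g_i(x)\ge0,\ i=1,\dots,m\}$ and $f^\star=\inf_{x\in S(g)}f(x)$, and assume $S(g)\subset\mathbb R^n_+$. Let $r\in(0,1)$ and assume there exist indices $i_1,i_2\in\{1,\dots,m\}$ such that $g_{i_j}=c_j[r^j-(x_1+\dots+x_n)^j]$ with $c_j>0$, for $j=1,2$. Let $\lambda_k$ be the value of the order-$k$ sum-of-squares relaxation and $\hat\lambda_k$ the value of the relaxed semidefinite program given in the context. Suppose that: (a) there exist $\underline\lambda\in\mathbb R$ and a positive measure $\mu$ supported on $S(g)$ with $\underline\lambda\le\lambda_k$ and $\int(f-\underline\lambda)\,d\mu\,/\,\lambda_{\min}(D_k(g\mu))\le 1$; (b) $\|g_i\|_{\ell_1}\le1$ for $i=1,\dots,m$. Assume strong duality holds for the semidefinite programs defining $\hat\lambda_k$ and $\hat\tau_k$ (see context). Let $\hat\lambda_k^{(\varepsilon)}$ be the value returned by the algorithm CON-INEQ (described in the context), run with $\varepsilon$, $\underline\lambda$ and a point $a\in S(g)$. Then $\lambda_k\le\hat\lambda_k\le f^\star$ and $$0\le\hat\lambda_k^{(\varepsilon)}-\hat\lambda_k\le\varepsilon\left(2+\frac{r}{1-r}\right).$$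
   Context: Notation. $\mathbb N^n_t=\{\alpha\in\mathbb N^n:|\alpha|\le t\}$; $\mathbb R[x]_t$: real polynomials in $x=(x_1,\dots,x_n)$ of degree at most $t$; $f=\sum f_\alpha x^\alpha$, $g_i=\sum g_{i,\alpha}x^\alpha$; $d=\lceil\deg(f)/2\rceil$, $d_i=\lceil\deg(g_i)/2\rceil$; $\|p\|_{\ell_1}$ is the sum of absolute values of the coefficients of $p$; $v_t=(x^\alpha)_{\alpha\in\mathbb N^n_t}$; $\mathbb S^N$: real symmetric $N\times N$ matrices. For $y=(y_\alpha)_{\alpha\in\mathbb N^n_{2k}}$: $M_k(y)=(y_{\alpha+\beta})_{\alpha,\beta\in\mathbb N^n_k}$; $M_{k-d_i}(g_iy)=(\sum_\gamma g_{i,\gamma}y_{\alpha+\beta+\gamma})_{\alpha,\beta\in\mathbb N^n_{k-d_i}}$; $L_y(\sum p_\alpha x^\alpha)=\sum p_\alpha y_\alpha$; $D_k(gy)=\operatorname{diag}((M_{k-d_i}(g_iy))_{i=0,\dots,m})$. For a measure $\mu$ with finite moments, $D_k(g\mu)=D_k(gy)$ with $y_\alpha=\int x^\alpha d\mu$. $\lambda_{\min}(\cdot)$ of a matrix is its smallest eigenvalue (implicitly positive in (a)). Coefficient-matching matrices. For $i=0,\dots,m$ and $\eta\in\mathbb N^n$, $B_i^{(\eta)}$ is the matrix indexed by $\mathbb N^n_{k-d_i}$ with $(\alpha,\beta)$-entry $1$ if $\alpha+\beta=\eta$ and $0$ otherwise; for $\gamma\in\mathbb N^n_{2k}$, $B_g^{(\gamma)}=\operatorname{diag}\big(\big(\sum_{\zeta\in\mathbb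 N^n_{2d_i},\,\gamma-\zeta\in\mathbb N^n}g_{i,\zeta}B_i^{(\gamma-\zeta)}\big)_{i=0,\dots,m}\big)$. Semidefinite programs. SOS relaxation: $\lambda_k=\sup\{\lambda:\ \lambda\in\mathbb R,\ G=\operatorname{diag}(G_0,\dots,G_m)\succeq0,\ f-\lambda=\sum_{i=0}^mg_iv_{k-d_i}^\top G_iv_{k-d_i}\}$; equivalently $f_0-\lambda=\operatorname{tr}(B_g^{(0)}G)$ and $f_\gamma=\operatorname{tr}(B_g^{(\gamma)}G)$ for $\gamma\in\mathbb N^n_{2k}\setminus\{0\}$. Relaxed program: $\hat\lambda_k=\sup\{\lambda:\ \lambda\in\mathbb R,\ G=\operatorname{diag}(G_0,\dots,G_m)\succeq0,\ f_0-\lambda\ge\operatorname{tr}(B_g^{(0)}G),\ f_\gamma\ge\operatorname{tr}(B_g^{(\gamma)}G)\ \forall\gamma\in\mathbb N^n_{2k}\setminus\{0\}\}$. Its dual: $\hat\tau_k=\min\{L_y(f): y=(y_\alpha)_{\alpha\in\mathbb N^n_{2k}}\subset\mathbb R_+,\ y_0=1,\ M_k(y)\succeq0,\ M_{k-d_i}(g_iy)\succeq0,\ i=1,\dots,m\}$. Strong duality means $\hat\lambda_k=\hat\tau_k$ and both problems have optimal solutions. Hamiltonian updates HU. Input: $\varepsilon>0$, $A'_1,\dots,A'_{M'}\in\mathbb S^N$, $b'_1,\dots,b'_{M'}\in\mathbb R$ (encoding: find $X\succeq0$ with $\operatorname{tr}X=1$, $\operatorname{tr}(A'_jX)\le b'_j$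 for all $j$). Set $W^{(1)}=I_N$ and $T'=\lceil 16\log(N)/\varepsilon^2\rceil$. For $t=1,\dots,T'$: set $P^{(t)}=W^{(t)}/\operatorname{tr}(W^{(t)})$; if some $j^{(t)}$ satisfies $\operatorname{tr}(A'_{j^{(t)}}P^{(t)})>b'_{j^{(t)}}+\varepsilon$, choose one and set $M^{(t)}=\frac12(I_N-A'_{j^{(t)}})$; otherwise stop with output $\eta=1$. Set $W^{(t+1)}=\exp\big(\frac{\varepsilon}{4}\sum_{s=1}^tM^{(s)}\big)$. If the loop completes, output $\eta=0$. Binary search BS-INEQ. Input: $C,A_1,\dots,A_M\in\mathbb S^N$, $b\in\mathbb R^M$, reals $\lambda_{\min}<\lambda_{\max}$, $\varepsilon>0$. Set $\underline\lambda_0=\lambda_{\min}$, $\overline\lambda_0=\lambda_{\max}$, $T=\lceil\log_2((\lambda_{\max}-\lambda_{\min})/\varepsilon)\rceil$ (no iterations if $T\le 0$). For $t=0,\dots,T-1$: let $\lambda_t=(\underline\lambda_t+\overline\lambda_t)/2$; run HU with accuracy $\varepsilon$ on the constraints $\operatorname{tr}(A_iX)\le b_i$ ($i=1,\dots,M$), $\operatorname{tr}(CX)\le\lambda_t$; if $\eta=0$ set $(\underline\lambda_{t+1},\overline\lambda_{t+1})=(\lambda_t,\overline\lambda_t)$, if $\eta=1$ set $(\underline\lambda_{t+1},\overline\lambda_{t+1})=(\underline\lambda_t,\lambda_t)$. Output: the final lower value $\underline\lambda_T$. Algorithm CON-INEQ. Enumerate $\mathbb N^n_{2k}=\{\gamma_0=0,\gamma_1,\dots,\gamma_M\}$,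 $M=\binom{n+2k}{n}-1$. Put $C=\operatorname{diag}(B_g^{(0)},0)$, $A_i=\operatorname{diag}(B_g^{(\gamma_i)},0)$, $b_i=f_{\gamma_i}$ ($i=1,\dots,M$), of size $N=1+\sum_{i=0}^m\binom{n+k-d_i}{n}$; $\lambda_{\min}=f_0-f(a)$, $\lambda_{\max}=f_0-\underline\lambda$ (with $\lambda_{\min}<\lambda_{\max}$ as required by BS-INEQ). Run BS-INEQ and return $\hat\lambda_k^{(\varepsilon)}=f_0-\underline\lambda_T$. *)

(* Defs.v *)
From HB Require Import structures.
From mathcomp Require Import all_boot all_order all_algebra.
From mathcomp Require Import all_classical all_reals all_analysis.
(* The notations of mpoly clash with those of MathComp-Analysis; the ones
   needed are reintroduced below. *)
From mathcomp Require Import -(notations) mpoly.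
Set Implicit Arguments.
Unset Strict Implicit.
Unset Printing Implicit Defensive.
Import Order.TTheory GRing.Theory Num.Theory numFieldNormedType.Exports.
Local Open Scope classical_set_scope.
Local Open Scope ring_scope.

Notation "{ 'mpoly' T [ n ] }" := (mpoly n T)
  (at level 0, T at level 2, n at level 2, format "{ 'mpoly'  T [ n ] }").
Notation "p @_ m" := (mcoeff m p) (at level 3, m at level 2, left associativity, format "p @_ m").
Notation "p .@[ v ]" := (meval v p) (at level 2, format "p .@[ v ]").

(* The zero polynomial is given degree 0. *)
Definition mpdeg (R : realType) (n : nat) (p : {mpoly R[n]}) : nat :=
  (mmeasure mdeg p).-1.

Definition halfdeg (R : realType) (n : nat) (p : {mpoly R[n]}) : nat :=
  uphalf (mpdeg p).

Definition l1norm (R : realType) (n : nat) (p : {mpoly R[n]}) : R :=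
  \sum_(a <- msupp p) `|p@_a|.

Definition feasible_set (R : realType) (n m : nat) (g : 'I_m.+1 -> {mpoly R[n]})
    : set 'rV[R]_n :=
  [set x | forall i : 'I_m.+1, (0 < i)%N -> 0 <= (g i).@[x ord0]].

Definition fstar (R : realType) (n m : nat) (f : {mpoly R[n]})
    (g : 'I_m.+1 -> {mpoly R[n]}) : \bar R :=
  ereal_inf [set (f.@[x ord0])%:E | x in feasible_set g].

(* Matrices indexed by the monomials of degree at most t are indexed by
   'I_(nmon n t), through the enumeration mon. *)
Definition nmon (n t : nat) : nat := #|{: bmultinom n t.+1}|.

Lemma nmon_bin (n t : nat) : nmon n t = 'C(n + t, n).
Proof.
rewrite -card_partial_ord_partitions /nmon.
pose F (w : n.-tuple 'I_t.+1) : multinom n :=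
  Multinom [tuple nat_of_ord (tnth w i) | i < n].
pose H (c : bmultinom n t.+1) : n.-tuple 'I_t.+1 :=
  [tuple inord (bmnm c i) | i < n].
have cle (c : bmultinom n t.+1) i : (bmnm c i <= t)%N.
  by have := bmdeg c; rewrite ltnS; apply: leq_trans; rewrite mdegE (bigD1 i) //= leq_addr.
have HE c i : nat_of_ord (tnth (H c) i) = bmnm c i.
  by rewrite tnth_mktuple inordK // ltnS.
have FE w i : F w i = tnth w i by rewrite /fun_of_multinom /= tnth_mktuple.
have injH : injective H.
  by move=> c d cd; apply/val_inj/mnmP => i /=; rewrite -!HE cd.
rewrite -(card_imset _ injH); apply: eq_card => w; rewrite !inE.
apply/imsetP/idP => [[c _ ->]|wt].
  rewrite big_tuple; have := bmdeg c; rewrite ltnS; apply: leq_trans.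
  by rewrite mdegE leq_eqVlt; apply/orP; left; apply/eqP/eq_bigr => i _; exact: HE.
have Fw : (mdeg (F w) < t.+1)%N.
  rewrite ltnS; apply: leq_trans wt; rewrite big_tuple mdegE leq_eqVlt.
  by apply/orP; left; apply/eqP/eq_bigr => i _; exact: FE.
by exists (BMultinom Fw) => //; apply: eq_from_tnth => i; apply: val_inj; rewrite /= HE FE.
Qed.

Definition mon (n t : nat) (i : 'I_(nmon n t)) : multinom n :=
  bmnm (enum_val i).

Definition monvec (R : realType) (n t : nat) : 'cV[{mpoly R[n]}]_(nmon n t) :=
  \col_i mpolyX R (mon i).

Definition psd (R : realType) (N : nat) (A : 'M[R]_N) : Prop :=
  A^T = A /\ forall v : 'rV[R]_N, 0 <= (v *m A *m v^T) ord0 ord0.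

Definition lambda_min (R : realType) (N : nat) (A : 'M[R]_N) : R :=
  inf [set l : R | eigenvalue A l].

Definition expmx (R : realType) (N : nat) (A : 'M[R]_N) : 'M[R]_N :=
  limn (series (fun i : nat => (i`!%:R)^-1 *: A ^+ i)).

(* A truncated sequence is represented by a total function y on monomials; in an
   order-k program only its values in degree at most 2k are used. *)
Definition momentmx (R : realType) (n t : nat) (y : multinom n -> R)
    : 'M[R]_(nmon n t) :=
  \matrix_(i, j) y (mnm_add (mon i) (mon j)).

Definition locmx (R : realType) (n t : nat) (p : {mpoly R[n]})
    (y : multinom n -> R) : 'M[R]_(nmon n t) :=
  \matrix_(i, j)
    \sum_(c <- msupp p) p@_c * y (mnm_add (mnm_add (mon i) (mon j)) c).

Definition riesz (R : realType) (n : nat) (y : multinom n -> R)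
    (p : {mpoly R[n]}) : R :=
  \sum_(a <- msupp p) p@_a * y a.

Definition bsize (R : realType) (n m : nat) (g : 'I_m.+1 -> {mpoly R[n]})
    (k : nat) (i : 'I_m.+1) : nat := nmon n (k - halfdeg (g i)).

Definition bdim (R : realType) (n m : nat) (g : 'I_m.+1 -> {mpoly R[n]})
    (k : nat) : nat := (\sum_(i < m.+1) bsize g k i)%N.

Definition Dmx (R : realType) (n m : nat) (g : 'I_m.+1 -> {mpoly R[n]})
    (k : nat) (y : multinom n -> R) : 'M[R]_(bdim g k) :=
  \mxdiag_(i < m.+1) locmx (k - halfdeg (g i)) (g i) y.

Definition borelRn (R : realType) (n : nat) :=
  g_sigma_algebraType (@open 'rV[R]_n).

Definition monfun (R : realType) (n : nat) (a : multinom n) (x : borelRn R n)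
    : R := (mpolyX R a).@[(x : 'rV[R]_n) ord0].

Definition finite_moments (R : realType) (n : nat)
    (mu : {measure set (borelRn R n) -> \bar R}) : Prop :=
  forall a : multinom n, mu.-integrable setT (EFin \o monfun a).

Definition moments (R : realType) (n : nat)
    (mu : {measure set (borelRn R n) -> \bar R}) (a : multinom n) : R :=
  \int[mu]_x monfun a x.

Definition Bblock (R : realType) (n t : nat) (eta : multinom n)
    : 'M[R]_(nmon n t) :=
  \matrix_(i, j) (mnm_add (mon i) (mon j) == eta)%:R.

(* lem z c is the componentwise order z <= c, that is, c - z is in N^n. *)
Definition Bmx (R : realType) (n m : nat) (g : 'I_m.+1 -> {mpoly R[n]})
    (k : nat) (c : multinom n) : 'M[R]_(bdim g k) :=
  \mxdiag_(i < m.+1)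
    \sum_(z : bmultinom n (2 * halfdeg (g i)).+1 | lem z c)
      (g i)@_z *: Bblock R (k - halfdeg (g i)) (mnm_sub c z).

Definition sos_feasible (R : realType) (n m : nat) (f : {mpoly R[n]})
    (g : 'I_m.+1 -> {mpoly R[n]}) (k : nat) (l : R)
    (G : forall i : 'I_m.+1, 'M[R]_(bsize g k i)) : Prop :=
  psd (\mxdiag_i G i) /\
  f - mpolyC n l = \sum_(i < m.+1) g i *
    ((monvec R n (k - halfdeg (g i)))^T *m map_mx (@mpolyC n R) (G i)
       *m monvec R n (k - halfdeg (g i))) ord0 ord0.

Definition lambda_sos (R : realType) (n m : nat) (f : {mpoly R[n]})
    (g : 'I_m.+1 -> {mpoly R[n]}) (k : nat) : \bar R :=
  ereal_sup [set l%:E | l in [set l | exists G, @sos_feasible R n m f g k l G]].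

Definition rel_feasible (R : realType) (n m : nat) (f : {mpoly R[n]})
    (g : 'I_m.+1 -> {mpoly R[n]}) (k : nat) (l : R)
    (G : forall i : 'I_m.+1, 'M[R]_(bsize g k i)) : Prop :=
  [/\ psd (\mxdiag_i G i),
      \tr (Bmx g k mnm0 *m \mxdiag_i G i) <= f@_mnm0 - l
    & forall c : multinom n, (mdeg c <= 2 * k)%N -> c != mnm0 ->
        \tr (Bmx g k c *m \mxdiag_i G i) <= f@_c].

Definition lambda_hat (R : realType) (n m : nat) (f : {mpoly R[n]})
    (g : 'I_m.+1 -> {mpoly R[n]}) (k : nat) : \bar R :=
  ereal_sup [set l%:E | l in [set l | exists G, @rel_feasible R n m f g k l G]].

Definition dual_feasible (R : realType) (n m : nat)
    (g : 'I_m.+1 -> {mpoly R[n]}) (k : nat) (y : multinom n -> R) : Prop :=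
  [/\ forall c : multinom n, (mdeg c <= 2 * k)%N -> 0 <= y c,
      y mnm0 = 1,
      psd (momentmx k y)
    & forall i : 'I_m.+1, (0 < i)%N -> psd (locmx (k - halfdeg (g i)) (g i) y)].

Definition tau_hat (R : realType) (n m : nat) (f : {mpoly R[n]})
    (g : 'I_m.+1 -> {mpoly R[n]}) (k : nat) : \bar R :=
  ereal_inf [set (riesz y f)%:E | y in dual_feasible g k].

Definition strong_duality (R : realType) (n m : nat) (f : {mpoly R[n]})
    (g : 'I_m.+1 -> {mpoly R[n]}) (k : nat) : Prop :=
  [/\ lambda_hat f g k = tau_hat f g k,
      exists l G, @rel_feasible R n m f g k l G /\ l%:E = lambda_hat f g k
    & exists y, dual_feasible g k y /\ (riesz y f)%:E = tau_hat f g k].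

(* HU leaves the choice of the violated constraint open, so the algorithms are
   given as relations between inputs and possible outputs. *)

Definition ceil_nat (R : realType) (x : R) : nat :=
  absz (Num.max 0 (Num.ceil x)).

Definition log2 (R : realType) (x : R) : R := ln x / ln 2.

Definition normalize (R : realType) (N : nat) (W : 'M[R]_N) : 'M[R]_N :=
  (\tr W)^-1 *: W.

(* [HU_loop eps A b q S W eta]: with q rounds left, S the sum of the M^(s) so
   far and W the current W^(t), the loop may output eta. *)
Inductive HU_loop (R : realType) (N M' : nat) (eps : R) (A : 'I_M' -> 'M[R]_N)
    (b : 'I_M' -> R) : nat -> 'M[R]_N -> 'M[R]_N -> bool -> Prop :=
| HU_exhausted S W : HU_loop eps A b 0 S W false
| HU_stop q S W :
    (forall j, \tr (A j *m normalize W) <= b j + eps) ->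
    HU_loop eps A b q.+1 S W true
| HU_update q S W j eta :
    b j + eps < \tr (A j *m normalize W) ->
    HU_loop eps A b q (S + 2^-1 *: (1%:M - A j))
      (expmx ((eps / 4) *: (S + 2^-1 *: (1%:M - A j)))) eta ->
    HU_loop eps A b q.+1 S W eta.

Definition HU (R : realType) (N M' : nat) (eps : R) (A : 'I_M' -> 'M[R]_N)
    (b : 'I_M' -> R) (eta : bool) : Prop :=
  HU_loop eps A b (ceil_nat (16 * ln N%:R / eps ^+ 2)) 0 1%:M eta.

(* The family u_0, ..., u_(M-1) followed by z. *)
Definition fcons_last (T : Type) (M : nat) (u : 'I_M -> T) (z : T)
    (j : 'I_M.+1) : T := oapp u z (unlift ord_max j).

Inductive BS_loop (R : realType) (N M : nat) (C : 'M[R]_N) (A : 'I_M -> 'M[R]_N)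
    (b : 'I_M -> R) (eps : R) : nat -> R -> R -> R -> Prop :=
| BS_done lo hi : BS_loop C A b eps 0 lo hi lo
| BS_raise q lo hi out :
    HU eps (fcons_last A C) (fcons_last b ((lo + hi) / 2)) false ->
    BS_loop C A b eps q ((lo + hi) / 2) hi out ->
    BS_loop C A b eps q.+1 lo hi out
| BS_lower q lo hi out :
    HU eps (fcons_last A C) (fcons_last b ((lo + hi) / 2)) true ->
    BS_loop C A b eps q lo ((lo + hi) / 2) out ->
    BS_loop C A b eps q.+1 lo hi out.

Definition BS_INEQ (R : realType) (N M : nat) (C : 'M[R]_N)
    (A : 'I_M -> 'M[R]_N) (b : 'I_M -> R) (lmin lmax eps out : R) : Prop :=
  BS_loop C A b eps (ceil_nat (log2 ((lmax - lmin) / eps))) lmin lmax out.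

(* diag(B_g^(c), 0), with one extra row and column. *)
Definition pad0 (R : realType) (N : nat) (B : 'M[R]_N) : 'M[R]_(N + 1) :=
  block_mx B 0 0 (0 : 'M[R]_1).

Definition ncon (n k : nat) : nat := 'C(n + 2 * k, n).-1.

(* gam is an enumeration gamma_0 = 0, gamma_1, ..., gamma_M of the monomials of
   degree at most 2k. *)
Definition CON_INEQ (R : realType) (n m : nat) (f : {mpoly R[n]})
    (g : 'I_m.+1 -> {mpoly R[n]}) (k : nat)
    (gam : 'I_(ncon n k).+1 -> bmultinom n (2 * k).+1)
    (eps lb : R) (a : 'rV[R]_n) (out : R) : Prop :=
  exists2 low : R,
    BS_INEQ (pad0 (Bmx g k mnm0))
      (fun i : 'I_(ncon n k) => pad0 (Bmx g k (gam (lift ord0 i))))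
      (fun i : 'I_(ncon n k) => f@_(gam (lift ord0 i)))
      (f@_mnm0 - f.@[a ord0]) (f@_mnm0 - lb) eps low
  & out = f@_mnm0 - low.

Lemma HU_loop_total (R : realType) (N M' : nat) (eps : R)
    (A : 'I_M' -> 'M[R]_N) (b : 'I_M' -> R) (q : nat) (S W : 'M[R]_N) :
  exists eta, HU_loop eps A b q S W eta.
Proof.
elim: q S W => [|q IH] S W; first by exists false; constructor.
have [[j hj]|h] :=
  pselect (exists j, b j + eps < \tr (A j *m normalize W)).
  have [eta hu] := IH (S + 2^-1 *: (1%:M - A j))
    (expmx ((eps / 4) *: (S + 2^-1 *: (1%:M - A j)))).
  by exists eta; apply: (HU_update hj).
by exists true; apply: HU_stop => j; rewrite leNgt; apply/negP => hj; apply: h; exists j.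
Qed.

Lemma BS_loop_total (R : realType) (N M : nat) (C : 'M[R]_N)
    (A : 'I_M -> 'M[R]_N) (b : 'I_M -> R) (eps : R) (q : nat) (lo hi : R) :
  exists out, BS_loop C A b eps q lo hi out.
Proof.
elim: q lo hi => [|q IH] lo hi; first by exists lo; constructor.
have [eta hu] : exists eta,
  HU eps (fcons_last A C) (fcons_last b ((lo + hi) / 2)) eta
  by exact: HU_loop_total.
case: eta hu => hu.
  by have [out o] := IH lo ((lo + hi) / 2); exists out; apply: BS_lower.
by have [out o] := IH ((lo + hi) / 2) hi; exists out; apply: BS_raise.
Qed.

Lemma CON_INEQ_total (R : realType) (n m : nat) (f : {mpoly R[n]})
    (g : 'I_m.+1 -> {mpoly R[n]}) (k : nat)
    (gam : 'I_(ncon n k).+1 -> bmultinom n (2 * k).+1)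
    (eps lb : R) (a : 'rV[R]_n) : exists out, CON_INEQ f g gam eps lb a out.
Proof.
have [low h] : exists low, BS_INEQ (pad0 (Bmx g k mnm0))
      (fun i : 'I_(ncon n k) => pad0 (Bmx g k (gam (lift ord0 i))))
      (fun i : 'I_(ncon n k) => f@_(gam (lift ord0 i)))
      (f@_mnm0 - f.@[a ord0]) (f@_mnm0 - lb) eps low by exact: BS_loop_total.
by exists (f@_mnm0 - low), low.
Qed.

(* Main.v *)
(** The relaxed program is the search for a matrix [G >= 0] under the constraints
    [tr (B^(c) G) <= f_c], and [sum_c y_c B^(c) = D_k(g y)] for every sequence [y].
    Pairing with the moments of [mu], which are nonnegative because [S(g)] lies in
    the orthant, gives [lambda_min (D_k(g mu)) tr G <= \int (f - lb)], so an
    optimal [G] has trace at most 1 and, padded by one slack entry, is a density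
    matrix. Pairing with an optimal dual sequence [y] shows that a density matrix
    violating the constraints by at most [eps] loses at most [eps * sum_c y_c] in
    the objective; with [s = x_1 + ... + x_n], the two constraints
    [r^j - s^j >= 0] give [L_y(s^j) <= r^j], hence [sum_c y_c <= 1 / (1 - r)].
    These two facts bracket each answer of the oracle HU in the bisection.

    HU is analyzed through the free energy [F(H) = ln tr exp H]. Instead of the
    Golden-Thompson inequality, its increment is written as a linear term plus a
    relative entropy of Gibbs states, bounded by the symmetrized relative entropy
    [J = tr ((P - P') (log P - log P'))]. When [H' - H = eta (1 - A)] with
    [|A| <= 1], [J] equals [eta tr ((P - P') A)]; expanding both sides in
    eigenbases of [H] and [H'], a Pinsker-type estimate gives [J <= 2 eta^2]. *)

Require Import Defs.
From HB Require Import structures.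
From mathcomp Require Import all_boot all_order all_algebra.
From mathcomp Require Import all_classical all_reals all_analysis.
From mathcomp Require Import ring lra zify.
From mathcomp Require Import -(notations) mpoly ssrcomplements.
Import Order.TTheory GRing.Theory Num.Theory numFieldNormedType.Exports.
Local Open Scope classical_set_scope.
Local Open Scope ring_scope.

(* Instance resolution does not find [nbhs_filter] on matrices by itself. *)
#[local] Instance mx_nbhs_filter (R : realType) m n (M : 'M[R]_(m, n)) :
  Filter (nbhs M) := nbhs_filter M.

(** * Quadratic forms and the spectral theorem for real symmetric matrices *)

Section QuadraticForms.
Variable R : realType.
Set Implicit Arguments.
Unset Strict Implicit.

Definition dotr {n : nat} (u v : 'rV[R]_n) : R := (u *m v^T) ord0 ord0.

Lemma dotrE n (u v : 'rV[R]_n) : dotr u v = \sum_i u ord0 i * v ord0 i.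
Proof. by rewrite /dotr mxE; apply: eq_bigr => i _; rewrite mxE. Qed.

Lemma dotrC n (u v : 'rV[R]_n) : dotr u v = dotr v u.
Proof. by rewrite !dotrE; apply: eq_bigr => i _; rewrite mulrC. Qed.

Lemma dotrDl n (u v w : 'rV[R]_n) : dotr (u + v) w = dotr u w + dotr v w.
Proof. by rewrite /dotr mulmxDl mxE. Qed.

Lemma dotrZl n c (u w : 'rV[R]_n) : dotr (c *: u) w = c * dotr u w.
Proof. by rewrite /dotr -scalemxAl mxE. Qed.

Lemma dotrDr n (u v w : 'rV[R]_n) : dotr w (u + v) = dotr w u + dotr w v.
Proof. by rewrite dotrC dotrDl !(dotrC w). Qed.

Lemma dotrZr n c (u w : 'rV[R]_n) : dotr w (c *: u) = c * dotr w u.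
Proof. by rewrite dotrC dotrZl dotrC. Qed.

Lemma dotr_mulmx m n (u : 'rV[R]_m) (A : 'M[R]_(m, n)) (v : 'rV[R]_n) :
  dotr (u *m A) v = dotr u (v *m A^T).
Proof. by rewrite /dotr trmx_mul trmxK mulmxA. Qed.

Lemma dotr_ge0 n (u : 'rV[R]_n) : 0 <= dotr u u.
Proof. by rewrite dotrE sumr_ge0 // => i _; rewrite -expr2 sqr_ge0. Qed.

Lemma dotr_eq0 n (u : 'rV[R]_n) : (dotr u u == 0) = (u == 0).
Proof.
apply/eqP/eqP => [|->]; last by rewrite /dotr mul0mx mxE.
rewrite dotrE => /eqP; rewrite psumr_eq0 => [/allP h|i _]; last first.
  by rewrite -expr2 sqr_ge0.
apply/rowP => i; rewrite mxE; have := h i (mem_index_enum _).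
by rewrite /= mulf_eq0 orbb => /eqP.
Qed.

Lemma dotr_gt0 n (u : 'rV[R]_n) : u != 0 -> 0 < dotr u u.
Proof. by move=> u0; rewrite lt_neqAle eq_sym dotr_eq0 u0 dotr_ge0. Qed.

Lemma psdP n (A : 'M[R]_n) :
  psd A <-> A^T = A /\ forall v : 'rV[R]_n, 0 <= dotr (v *m A) v.
Proof. by []. Qed.

(** With [w = c *m A], moving from [c] by [t *: w] changes the form by [2 * t * dotr w w] to first
    order, which is negative for small [t < 0] unless [w = 0]. *)
Lemma psd_ker n (A : 'M[R]_n) (c : 'rV[R]_n) :
  psd A -> dotr (c *m A) c = 0 -> c *m A = 0.
Proof.
move=> /psdP[sA pA] c0; apply/eqP; rewrite -dotr_eq0; apply/negPn/negP => q0.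
set w := c *m A in q0 *; set q := dotr w w in q0.
have qp : 0 < q by rewrite lt_neqAle eq_sym q0 dotr_ge0.
pose s := dotr (w *m A) w; have s0 : 0 <= s by exact: pA.
have e t : dotr ((c + t *: w) *m A) (c + t *: w) = t * (2 * q + t * s).
  rewrite mulmxDl -scalemxAl !(dotrDl, dotrDr, dotrZl, dotrZr) c0.
  rewrite (_ : dotr (w *m A) c = q) -/w -/q -/s; first by ring.
  by rewrite dotr_mulmx sA.
(* Dividing by [s + 1] covers the case [s = 0] and keeps the second factor in [e] positive. *)
have := pA (c + (- (q / (s + 1))) *: w); rewrite e leNgt => /negP; apply.
have s1 : 0 < s + 1 by rewrite ltr_wpDl.
set t := q / (s + 1); have tp : 0 < t by rewrite divr_gt0.
have ts : t * (s + 1) = q by rewrite mulfVK // gt_eqF.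
nra.
Qed.

Lemma mx_coord_continuous m n (i : 'I_m) (j : 'I_n) :
  continuous (fun M : 'M[R]_(m, n) => M i j).
Proof.
move=> M B BM.
exists (fun i' j' => if (i' == i) && (j' == j) then B else setT) => [i' j'|N /= h].
  by case: ifPn => [/andP[/eqP -> /eqP ->]|_] //; exact: filterT.
by have := h i j; rewrite !eqxx.
Qed.

Lemma mx_cvg T (F : set_system T) {FF : Filter F} m n (f : T -> 'M[R]_(m, n))
    (L : 'M[R]_(m, n)) :
  (forall i j, (fun t => f t i j) @ F --> L i j) -> f @ F --> L.
Proof.
move=> h; apply/cvg_ballP => e e0.
have : \forall t \near F, forall p : 'I_m * 'I_n, ball (L p.1 p.2) e (f t p.1 p.2).
  apply: filter_forall => -[i j] /=.
  by have /cvg_ballP := h i j; apply.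
by apply: filterS => t ht; split => // i j; exact: (ht (i, j)).
Qed.

Lemma cvg_sumr T (F : set_system T) {FF : Filter F} (I : Type) (s : seq I)
    (f : I -> T -> R) (l : I -> R) :
  (forall i, f i @ F --> l i) ->
  (fun t => \sum_(i <- s) f i t) @ F --> \sum_(i <- s) l i.
Proof.
move=> h; elim: s => [|i s IH].
  rewrite (_ : (fun t => _) = fun=> 0); last by apply/funext => t; rewrite big_nil.
  by rewrite big_nil; exact: cvg_cst.
rewrite (_ : (fun t => _) = fun t => f i t + \sum_(j <- s) f j t); last first.
  by apply/funext => t; rewrite big_cons.
by rewrite big_cons; apply: cvgD.
Qed.

Lemma continuous_dotr_mulmx n (A : 'M[R]_n) :
  continuous (fun v : 'rV[R]_n => dotr (v *m A) v).
Proof.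
move=> v; rewrite (_ : (fun v => _) = (fun v : 'rV[R]_n =>
  \sum_i (\sum_j v ord0 j * A j i) * v ord0 i)); last first.
  by apply/funext => w; rewrite dotrE; apply: eq_bigr => i _; rewrite mxE.
apply: cvg_sumr => i; apply: cvgM; last exact: mx_coord_continuous.
by apply: cvg_sumr => j; apply: cvgM; [exact: mx_coord_continuous|exact: cvg_cst].
Qed.

Lemma unit_sphere_compact n : compact [set v : 'rV[R]_n | dotr v v = 1].
Proof.
have c1 : continuous (fun v : 'rV[R]_n => dotr v v).
  move=> v; have := continuous_dotr_mulmx (A := 1%:M) (x := v).
  by under eq_fun do rewrite mulmx1.
have cl : closed [set v : 'rV[R]_n | dotr v v = 1].
  have -> : [set v : 'rV[R]_n | dotr v v = 1] =
     (fun v : 'rV[R]_n => dotr v v) @^-1` [set 1] by [].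
  by apply: preimage_closed => [v _|]; [exact: c1|exact: closed_eq].
apply: (@subclosed_compact _ _
  [set v : 'rV[R]_n | forall i, `[-1, 1]%classic (v ord0 i)]) => //.
  apply: (@rV_compact R n (fun=> `[(-1 : R), 1]%classic)) => _; exact: segment_compact.
move=> v /= v1 i; rewrite in_itv /= -ler_norml -(@ler_pXn2r _ 2) ?nnegrE //.
rewrite expr1n real_normK ?num_real // -v1 dotrE (bigD1 i) //= expr2 lerDl.
by rewrite sumr_ge0 // => j _; rewrite -expr2 sqr_ge0.
Qed.

(** A maximizer [u] of the form on the unit sphere has some value [l]; by homogeneity [l%:M - A] is
    positive semidefinite, and its form vanishes at [u], so [psd_ker] applies. *)
Lemma sym_eigenvector n (A : 'M[R]_n.+1) : A^T = A ->
  exists (l : R) (u : 'rV[R]_n.+1), dotr u u = 1 /\ u *m A = l *: u.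
Proof.
move=> sA.
have ne : [set v : 'rV[R]_n.+1 | dotr v v = 1] !=set0.
  exists (delta_mx ord0 ord0); rewrite /= dotrE (bigD1 ord0) //= big1 => [|i i0].
    by rewrite !mxE eqxx mulr1 addr0.
  by rewrite !mxE (negbTE i0) mulr0.
have cA : {within [set v : 'rV[R]_n.+1 | dotr v v = 1],
   continuous (fun v : 'rV[R]_n.+1 => dotr (v *m A) v)}.
  by apply: continuous_subspaceT; exact: continuous_dotr_mulmx.
have [u] := EVT_max_rV ne (@unit_sphere_compact _) cA.
rewrite inE /= => u1 umax; set l := dotr (u *m A) u in umax.
exists l, u; split => //.
suff : u *m (l%:M - A) = 0.
  by move/eqP; rewrite mulmxBr subr_eq0 => /eqP <-; rewrite mul_mx_scalar.
apply: psd_ker; last first.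
  rewrite mulmxBr mul_mx_scalar dotrDl dotrZl u1 mulr1 /dotr mulNmx mxE.
  by rewrite -/(dotr _ _) subrr.
apply/psdP; split=> [|v]; first by rewrite linearB /= sA tr_scalar_mx.
rewrite mulmxBr mul_mx_scalar -scaleN1r dotrDl !dotrZl mulN1r subr_ge0.
have [->|v0] := eqVneq v 0; first by rewrite /dotr !mul0mx mxE mulr0.
have vp := dotr_gt0 v0.
pose c := (Num.sqrt (dotr v v))^-1.
have c2 : c * c * dotr v v = 1.
  by rewrite -expr2 exprVn sqr_sqrtr ?dotr_ge0 // mulVf // gt_eqF.
have := umax (c *: v); rewrite inE /= dotrZl dotrZr mulrA c2 => /(_ erefl).
rewrite -scalemxAl dotrZl dotrZr mulrA => h.
have := ler_wpM2r (ltW vp) h.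
by rewrite (mulrAC _ (dotr (v *m A) v)) c2 mul1r.
Qed.

(* Householder: the reflection along u - v exchanges u and v. *)
Lemma unit_reflection n (u v : 'rV[R]_n) : dotr u u = 1 -> dotr v v = 1 ->
  exists U : 'M[R]_n, [/\ U^T = U, U *m U = 1%:M & v *m U = u].
Proof.
move=> u1 v1; have [->|uv] := eqVneq u v.
  by exists 1%:M; rewrite trmx1 !mulmx1.
pose w := v - u; have w0 : dotr w w != 0 by rewrite dotr_eq0 subr_eq0 eq_sym.
pose c := 2 / dotr w w.
have wwT : w *m w^T = (dotr w w)%:M by rewrite [LHS]mx11_scalar.
have vw : v *m w^T = (dotr v w)%:M by rewrite [LHS]mx11_scalar.
have e : dotr w w = 2 * dotr v w.
  rewrite /w -scaleN1r !(dotrDl, dotrDr, dotrZl, dotrZr) u1 v1 (dotrC u v); ring.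
exists (1%:M - c *: (w^T *m w)); split.
- by rewrite linearB /= trmx1 linearZ /= trmx_mul trmxK.
- set W := w^T *m w; have WW : W *m W = dotr w w *: W.
    by rewrite /W mulmxA -(mulmxA _ w) wwT mul_mx_scalar -scalemxAl.
  rewrite mulmxBr mulmx1 mulmxBl mul1mx -scalemxAl -scalemxAr WW !scalerA.
  have -> : c * c * dotr w w = c + c by rewrite -mulrA [c * dotr w w]divfK //; ring.
  by rewrite scalerDl opprB addrK addrNK.
- rewrite mulmxBr mulmx1 -scalemxAr mulmxA vw mul_scalar_mx scalerA.
  have -> : c * dotr v w = 1 by rewrite /c mulrAC -e mulfV.
  by rewrite scale1r /w opprB addrC addrNK.
Qed.

(** Induction on the size: a reflection carrying the first basis vector to a unit eigenvector splits
    off a block of size 1, symmetry clearing the first column along with the first row. *)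
Lemma sym_spectral n (A : 'M[R]_n) : A^T = A ->
  exists (Q : 'M[R]_n) (d : 'rV[R]_n),
    Q *m Q^T = 1%:M /\ A = Q^T *m diag_mx d *m Q.
Proof.
elim: n A => [|n IH] A sA.
  by exists 1%:M, 0; split; apply/matrixP => -[].
have [l [u [u1 uA]]] := sym_eigenvector sA.
rewrite -[n.+1]/(1 + n)%N in A sA u u1 uA *.
pose e0 : 'rV[R]_(1 + n) := row_mx 1%:M 0.
have e01 : dotr e0 e0 = 1.
  by rewrite /dotr tr_row_mx mul_row_col trmx0 mulmx0 addr0 trmx1 mulmx1 mxE.
have [U [sU U2 eU]] := unit_reflection u1 e01.
pose B : 'M[R]_(1 + n) := U *m A *m U.
have sB : B^T = B by rewrite /B !trmx_mul sU sA mulmxA.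
have eB : e0 *m B = l *: e0.
  rewrite /B !mulmxA eU uA -scalemxAl; congr (_ *: _).
  by rewrite -eU -mulmxA U2 mulmx1.
have uB : ursubmx B = 0.
  have : usubmx B = l *: e0.
    by rewrite -eB /e0 -{2}[B]vsubmxK mul_row_col mul1mx mul0mx addr0.
  by move=> ub; rewrite /ursubmx ub /e0 linearZ /= row_mxKr scaler0.
have ulB : ulsubmx B = l%:M.
  have : usubmx B = l *: e0.
    by rewrite -eB /e0 -{2}[B]vsubmxK mul_row_col mul1mx mul0mx addr0.
  by move=> ub; rewrite /ulsubmx ub /e0 linearZ /= row_mxKl scale_scalar_mx mulr1.
have dlB : dlsubmx B = 0 by rewrite -[B]sB -trmx_ursub uB trmx0.
have sD : (drsubmx B)^T = drsubmx B by rewrite trmx_drsub sB.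
have [Q [d [QQ De]]] := IH _ sD.
pose Q1 : 'M[R]_(1 + n) := block_mx 1%:M 0 0 Q.
exists (Q1 *m U), (row_mx l%:M d); split.
  rewrite trmx_mul sU mulmxA -(mulmxA Q1) U2 mulmx1 /Q1 tr_block_mx mulmx_block.
  by rewrite !(trmx0, trmx1, mulmx0, mul0mx, mulmx1, addr0, add0r) QQ -scalar_mx_block.
have -> : A = U *m B *m U by rewrite /B !mulmxA U2 mul1mx -mulmxA U2 mulmx1.
rewrite trmx_mul sU -!mulmxA; congr (_ *m _); rewrite !mulmxA; congr (_ *m _).
rewrite -[LHS]submxK ulB uB dlB De diag_mx_row /Q1 tr_block_mx !mulmx_block.
rewrite !(trmx0, trmx1, mulmx0, mul0mx, mulmx1, mul1mx, addr0, add0r).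
by congr block_mx; apply/matrixP => i j; rewrite !mxE !ord1.
Qed.

End QuadraticForms.

(** * Calculus in an eigenbasis: traces, exponential, smallest eigenvalue *)

Section SpectralCalculus.
Variable R : realType.
Set Implicit Arguments.
Unset Strict Implicit.

Definition spectral {n : nat} (A Q : 'M[R]_n) (d : 'rV[R]_n) : Prop :=
  Q *m Q^T = 1%:M /\ A = Q^T *m diag_mx d *m Q.

Section Decomposition.
Variables (n : nat) (A Q : 'M[R]_n) (d : 'rV[R]_n).
Hypothesis AQd : spectral A Q d.

Lemma spectral_trmxK : Q^T *m Q = 1%:M.
Proof. by case: AQd => /mulmx1C. Qed.

Lemma spectral_sym : A^T = A.
Proof. by case: AQd => _ ->; rewrite !trmx_mul trmxK tr_diag_mx mulmxA. Qed.

Lemma spectral_orthonormal i j : dotr (row i Q) (row j Q) = (i == j)%:R.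
Proof.
case: AQd => /matrixP/(_ i j) + _; rewrite !mxE => <-.
by rewrite dotrE; apply: eq_bigr => k _; rewrite !mxE.
Qed.

Lemma spectral_eigenvector i : row i Q *m A = d ord0 i *: row i Q.
Proof.
case: AQd => QQ ->; rewrite -!row_mul !mulmxA QQ mul1mx row_mul.
rewrite row_diag_mx -scalemxAl; congr (_ *: _).
by apply/rowP => j; rewrite -rowE.
Qed.

Lemma spectral_tr (M : 'M[R]_n) :
  \tr (A *m M) = \sum_i d ord0 i * dotr (row i Q *m M) (row i Q).
Proof.
case: AQd => _ ->; rewrite -!mulmxA mxtrace_mulC -!mulmxA; apply: eq_bigr => i _.
rewrite mul_diag_mx mxE; congr (_ * _).
by rewrite mulmxA mxE dotrE; apply: eq_bigr => k _; rewrite -row_mul !mxE.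
Qed.

Lemma spectral_tr1 : \tr A = \sum_i d ord0 i.
Proof.
rewrite -[A in LHS]mulmx1 spectral_tr; apply: eq_bigr => i _.
by rewrite mulmx1 spectral_orthonormal eqxx mulr1.
Qed.

Lemma spectral_dotr (u v : 'rV[R]_n) :
  dotr u v = \sum_i dotr u (row i Q) * dotr v (row i Q).
Proof.
have e w i : dotr w (row i Q) = (w *m Q^T) ord0 i.
  by rewrite dotrE mxE; apply: eq_bigr => k _; rewrite !mxE.
transitivity (dotr (u *m Q^T) (v *m Q^T)).
  by rewrite dotr_mulmx trmxK -mulmxA spectral_trmxK mulmx1.
by rewrite dotrE; apply: eq_bigr => i _; rewrite !e.
Qed.

Lemma spectral_form (v : 'rV[R]_n) :
  dotr (v *m A) v = \sum_i d ord0 i * dotr v (row i Q) ^+ 2.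
Proof.
rewrite spectral_dotr; apply: eq_bigr => i _.
by rewrite dotr_mulmx spectral_sym spectral_eigenvector dotrZr mulrA.
Qed.

Lemma spectral_eigenvalue l : eigenvalue A l -> exists i, l = d ord0 i.
Proof.
move=> /eigenvalueP[v vA v0].
have [i vi] : exists i, dotr v (row i Q) != 0.
  apply/existsP; apply: contraNT v0; rewrite negb_exists => /forallP h.
  rewrite -dotr_eq0 spectral_dotr big1 // => i _.
  by move: (h i); rewrite negbK => /eqP ->; rewrite mulr0.
exists i; apply: (mulIf vi); rewrite -dotrZl -vA dotr_mulmx spectral_sym.
by rewrite spectral_eigenvector dotrZr.
Qed.

Lemma lambda_min_le i : lambda_min A <= d ord0 i.
Proof.
apply: ge_inf.
  (* An infimum is a lower bound only for a set that has one; this sum bounds all eigenvalues from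
     below. *)
  exists (- \sum_j `|d ord0 j|) => _ /= /spectral_eigenvalue[j ->].
  rewrite lerNl (le_trans (ler_norm _)) // normrN (bigD1 j) //= lerDl.
  by rewrite sumr_ge0.
apply/eigenvalueP; exists (row i Q); first exact: spectral_eigenvector.
by rewrite -dotr_eq0 spectral_orthonormal eqxx oner_eq0.
Qed.

Lemma spectral_expr k :
  A ^+ k = Q^T *m diag_mx (map_mx (fun x => x ^+ k) d) *m Q.
Proof.
case: AQd => QQ ->; elim: k => [|k IH].
  rewrite expr0 (_ : diag_mx _ = 1%:M) ?mulmx1 ?spectral_trmxK //.
  by apply/matrixP => i j; rewrite !mxE expr0.
rewrite exprS IH -mulmxE !mulmxA; congr (_ *m _).
rewrite -(mulmxA _ Q) QQ mulmx1 -mulmxA mulmx_diag; congr (_ *m diag_mx _).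
by apply/rowP => i; rewrite !mxE exprS.
Qed.

(** The partial sums are diagonal in the same eigenbasis, so each entry is a finite combination of
    scalar exponential series. *)
Lemma spectral_expmx : spectral (expmx A) Q (map_mx expR d).
Proof.
split; first by case: AQd.
rewrite /expmx; apply: cvg_lim; first exact: norm_hausdorff.
apply: mx_cvg => i j.
have e (h : R -> R) : (Q^T *m diag_mx (map_mx h d) *m Q) i j =
    \sum_k Q k i * Q k j * h (d ord0 k).
  rewrite mxE; apply: eq_bigr => k _; rewrite mul_mx_diag !mxE.
  by rewrite mulrAC.
rewrite e (_ : (fun t => _) = fun t : nat =>
    \sum_k Q k i * Q k j * series (exp_coeff (d ord0 k)) t).
  apply: cvg_sumr => k; apply: cvgM; first exact: cvg_cst.
  exact: is_cvg_series_exp_coeff.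
apply/funext => t; rewrite /series /= summxE.
transitivity (\sum_(0 <= l < t) \sum_k Q k i * Q k j * exp_coeff (d ord0 k) l).
  apply: eq_bigr => l _; rewrite mxE spectral_expr e mulr_sumr.
  apply: eq_bigr => k _; rewrite /exp_coeff /=; ring.
by rewrite exchange_big /=; apply: eq_bigr => k _; rewrite mulr_sumr.
Qed.

End Decomposition.

Lemma psd_tr_mulmx n (A B : 'M[R]_n) : psd A -> psd B -> 0 <= \tr (A *m B).
Proof.
move=> /psdP[sA pA] /psdP[_ pB]; have [Q [d AQd]] := sym_spectral sA.
rewrite (spectral_tr AQd) sumr_ge0 // => i _; rewrite mulr_ge0 //.
have := pA (row i Q); rewrite (spectral_eigenvector AQd) dotrZl.
by rewrite (spectral_orthonormal AQd) eqxx mulr1.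
Qed.

Lemma lambda_min_tr n (A B : 'M[R]_n) : A^T = A -> psd B ->
  lambda_min A * \tr B <= \tr (A *m B).
Proof.
move=> sA /psdP[_ pB]; have [Q [d AQd]] := sym_spectral sA.
have -> : \tr B = \sum_i dotr (row i Q *m B) (row i Q).
  rewrite -[B in LHS]mul1mx (@spectral_tr _ 1%:M Q (const_mx 1)).
    by apply: eq_bigr => i _; rewrite mxE mul1r.
  split; first by case: AQd.
  by rewrite diag_const_mx mulmx1 (spectral_trmxK AQd).
rewrite (spectral_tr AQd) mulr_sumr ler_sum // => i _.
by rewrite ler_wpM2r // (lambda_min_le AQd).
Qed.

End SpectralCalculus.

(** * Gibbs states, relative entropy and free energy *)

Section Gibbs.
Variable R : realType.
Set Implicit Arguments.
Unset Strict Implicit.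

(* The polarized form of the operator norm bound |A| <= 1, which unlike the norm
   itself is additive in A. *)
Definition contraction {n : nat} (A : 'M[R]_n) : Prop :=
  forall u v : 'rV[R]_n, 2 * dotr (u *m A) v <= dotr u u + dotr v v.

Lemma contraction_dotr n (A : 'M[R]_n) (u : 'rV[R]_n) : contraction A ->
  dotr (u *m A) (u *m A) <= dotr u u.
Proof. by move=> /(_ u (u *m A)) h; lra. Qed.

(* AM-GM for eta * (p - q) * g * s with weight p + q, where p = expR a and
   q = expR b, together with |a - b| >= |p - q| / (p + q). *)
Lemma expR_quadratic_bound (eta a b g s : R) :
  2 * (eta * ((expR a - expR b) * (g * s))) <=
  (expR a - expR b) * (a - b) * s ^+ 2 + eta ^+ 2 * ((expR a + expR b) * g ^+ 2).
Proof.
set p := expR a; set q := expR b.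
have p0 : 0 < p by exact: expR_gt0.
have q0 : 0 < q by exact: expR_gt0.
have pq : p - q <= p * (a - b).
  have := expR_ge1Dx (b - a); rewrite expRD expRN -/p -/q => h.
  have e : p * (q / p) = q by rewrite mulrC divfK // gt_eqF.
  by have := ler_wpM2l (ltW p0) h; rewrite e; lra.
have qp : q - p <= q * (b - a).
  have := expR_ge1Dx (a - b); rewrite expRD expRN -/p -/q => h.
  have e : q * (p / q) = p by rewrite mulrC divfK // gt_eqF.
  by have := ler_wpM2l (ltW q0) h; rewrite e; lra.
have D : (p - q) ^+ 2 <= (p + q) * ((p - q) * (a - b)).
  have [ab|ab] := leP q p.
    have ab0 : 0 <= a - b by rewrite subr_ge0 -ler_expR.
    have h1 : p - q <= (p + q) * (a - b) by rewrite (le_trans pq) // ler_wpM2r // lerDl ltW.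
    have := ler_wpM2l (_ : 0 <= p - q) h1; rewrite subr_ge0 => /(_ ab); lra.
  have ab0 : 0 <= b - a by rewrite subr_ge0 -ler_expR ltW.
  have h1 : q - p <= (p + q) * (b - a) by rewrite (le_trans qp) // ler_wpM2r // lerDr ltW.
  have := ler_wpM2l (_ : 0 <= q - p) h1; rewrite subr_ge0 => /(_ (ltW ab)); lra.
rewrite -(ler_pM2l (addr_gt0 p0 q0)).
have Ds : (p - q) ^+ 2 * s ^+ 2 <= (p + q) * ((p - q) * (a - b)) * s ^+ 2.
  by rewrite ler_wpM2r // sqr_ge0.
have := sqr_ge0 ((p - q) * s - eta * (p + q) * g); nra.
Qed.

Section Divergence.
Variables (n : nat) (L L' Q U : 'M[R]_n) (a b : 'rV[R]_n).
Hypotheses (LQ : spectral L Q a) (LU : spectral L' U b).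
Hypotheses (trL : \tr (expmx L) = 1) (trL' : \tr (expmx L') = 1).

(** Overlaps of the two eigenbases. Their squares form a doubly stochastic matrix, and the traces
    below become double sums over pairs of eigenvectors. *)
Let c i j := dotr (row i Q) (row j U).

Let sum_p : \sum_i expR (a ord0 i) = 1.
Proof.
by rewrite -trL (spectral_tr1 (spectral_expmx LQ)); apply: eq_bigr => i _; rewrite mxE.
Qed.

Let sum_q : \sum_i expR (b ord0 i) = 1.
Proof.
by rewrite -trL' (spectral_tr1 (spectral_expmx LU)); apply: eq_bigr => i _; rewrite mxE.
Qed.

Let sum_c_r i : \sum_j c i j ^+ 2 = 1.
Proof.
rewrite -(_ : dotr (row i Q) (row i Q) = 1); last by rewrite (spectral_orthonormal LQ) eqxx.
by rewrite (spectral_dotr LU); apply: eq_bigr => j _; rewrite expr2.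
Qed.

Let sum_c_l j : \sum_i c i j ^+ 2 = 1.
Proof.
rewrite -(_ : dotr (row j U) (row j U) = 1); last by rewrite (spectral_orthonormal LU) eqxx.
by rewrite (spectral_dotr LQ); apply: eq_bigr => i _; rewrite -expr2 /c dotrC.
Qed.

Let tr_expL (M : 'M[R]_n) : M^T = M ->
  \tr (expmx L *m M) = \sum_i \sum_j
    expR (a ord0 i) * (dotr (row i Q *m M) (row j U) * c i j).
Proof.
move=> sM; rewrite (spectral_tr (spectral_expmx LQ)); apply: eq_bigr => i _.
by rewrite mxE (spectral_dotr LU) mulr_sumr.
Qed.

Let tr_expL' (M : 'M[R]_n) : M^T = M ->
  \tr (expmx L' *m M) = \sum_i \sum_j
    expR (b ord0 j) * (dotr (row i Q *m M) (row j U) * c i j).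
Proof.
move=> sM; rewrite (spectral_tr (spectral_expmx LU)) exchange_big; apply: eq_bigr => j _.
rewrite mxE (spectral_dotr LQ) mulr_sumr; apply: eq_bigr => i _.
by rewrite dotr_mulmx sM !(dotrC (row j U)).
Qed.

Let form_L i j : dotr (row i Q *m (L - L')) (row j U) = (a ord0 i - b ord0 j) * c i j.
Proof.
rewrite mulmxBr -scaleN1r dotrDl dotrZl (spectral_eigenvector LQ) dotrZl.
rewrite (dotr_mulmx _ L') (spectral_sym LU) (spectral_eigenvector LU) dotrZr.
by rewrite mulN1r mulrBl.
Qed.

Let symL : (L - L')^T = L - L'.
Proof. by rewrite linearB /= (spectral_sym LQ) (spectral_sym LU). Qed.

(* The right-hand side is the relative entropy of expmx L' with respect to
   expmx L. *)
Lemma klein : 0 <= \tr (expmx L' *m (L' - L)).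
Proof.
rewrite -opprB mulmxN linearN /= tr_expL' // oppr_ge0.
(* The exponential lies above its tangent at [b ord0 j]; double stochasticity then reduces the bound
   to a difference of two unit traces. *)
apply: (@le_trans _ _ (\sum_i \sum_j (expR (a ord0 i) - expR (b ord0 j)) * c i j ^+ 2)).
  apply: ler_sum => i _; apply: ler_sum => j _; rewrite form_L -mulrA -expr2 mulrA.
  rewrite ler_wpM2r ?sqr_ge0 //.
  have := expR_ge1Dx (a ord0 i - b ord0 j).
  set x := a _ _; set y := b _ _ => h.
  have -> : expR x = expR y * expR (x - y) by rewrite -expRD addrC subrK.
  have := ler_wpM2l (ltW (expR_gt0 y)) h; lra.
under eq_bigr do under eq_bigr do rewrite mulrBl.
under eq_bigr do rewrite big_split /= -mulr_sumr sum_c_r mulr1 sumrN.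
rewrite big_split /= sum_p sumrN exchange_big /=.
by under eq_bigr do rewrite -mulr_sumr sum_c_l mulr1; rewrite sum_q subrr.
Qed.

(** Summing [expR_quadratic_bound] over all pairs gives [2 * (eta * T) <= J + eta ^+ 2 * K]. The
    hypothesis [J = eta * T] makes this self-bounding: [J <= eta ^+ 2 * K], with [K <= 2]. *)
Lemma divergence_contraction (A : 'M[R]_n) (eta : R) :
  A^T = A -> contraction A ->
  \tr ((expmx L - expmx L') *m (L - L')) =
    eta * \tr ((expmx L - expmx L') *m A) ->
  \tr ((expmx L - expmx L') *m (L - L')) <= 2 * eta ^+ 2.
Proof.
move=> sA cA; set J := \tr _; set T := \tr _ => JT.
pose g i j := dotr (row i Q *m A) (row j U).
have eJ : J = \sum_i \sum_j (expR (a ord0 i) - expR (b ord0 j)) *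
    (a ord0 i - b ord0 j) * c i j ^+ 2.
  rewrite /J mulmxBl linearB /= tr_expL // tr_expL' // -sumrB.
  apply: eq_bigr => i _; rewrite -sumrB; apply: eq_bigr => j _.
  rewrite form_L; ring.
have eT : T = \sum_i \sum_j (expR (a ord0 i) - expR (b ord0 j)) * (g i j * c i j).
  rewrite /T mulmxBl linearB /= tr_expL // tr_expL' // -sumrB.
  by apply: eq_bigr => i _; rewrite -sumrB; apply: eq_bigr => j _; rewrite -mulrBl.
pose K := \sum_i \sum_j (expR (a ord0 i) + expR (b ord0 j)) * g i j ^+ 2.
(* The weights of each state sum to 1, and contractivity bounds each row sum and each column sum of
   [g i j ^+ 2] by 1. *)
have K2 : K <= 2.
  rewrite /K; under eq_bigr do under eq_bigr do rewrite mulrDl.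
  under eq_bigr do rewrite big_split /=.
  rewrite big_split /= -[2]/(1 + 1) lerD //.
    rewrite -sum_p; apply: ler_sum => i _; rewrite -mulr_sumr.
    rewrite ler_piMr ?expR_ge0 //.
    have := contraction_dotr (row i Q) cA.
    rewrite (spectral_orthonormal LQ) eqxx (spectral_dotr LU).
    by under eq_bigr do rewrite -expr2.
  rewrite -sum_q exchange_big; apply: ler_sum => j _ /=; rewrite -mulr_sumr.
  rewrite ler_piMr ?expR_ge0 //.
  have := contraction_dotr (row j U) cA.
  rewrite (spectral_orthonormal LU) eqxx (spectral_dotr LQ).
  by under eq_bigr do rewrite -expr2 dotr_mulmx sA dotrC.
have : 2 * (eta * T) <= J + eta ^+ 2 * K.
  rewrite eT eJ /K !mulr_sumr -big_split; apply: ler_sum => i _ /=.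
  rewrite !mulr_sumr -big_split; apply: ler_sum => j _ /=.
  exact: expR_quadratic_bound.
rewrite -JT; have := sqr_ge0 eta; nra.
Qed.

End Divergence.

Definition free_energy {n : nat} (H : 'M[R]_n) : R := ln (\tr (expmx H)).

Definition gibbs {n : nat} (H : 'M[R]_n) : 'M[R]_n := normalize (expmx H).

Lemma spectral_shift n (H Q : 'M[R]_n) d (c : R) : spectral H Q d ->
  spectral (H - c%:M) Q (map_mx (fun x => x - c) d).
Proof.
move=> HQ; split; first by case: HQ.
rewrite (_ : diag_mx _ = diag_mx d - c%:M).
  rewrite mulmxBr mulmxBl mul_mx_scalar -scalemxAl (spectral_trmxK HQ) scalemx1.
  by case: HQ => _ <-.
by apply/matrixP => i j; rewrite !mxE; case: eqP; rewrite ?mulr1n ?mulr0n ?subr0.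
Qed.

Lemma tr_expmx n (H Q : 'M[R]_n) d : spectral H Q d ->
  \tr (expmx H) = \sum_i expR (d ord0 i).
Proof.
by move=> HQ; rewrite (spectral_tr1 (spectral_expmx HQ)); apply: eq_bigr => i _; rewrite mxE.
Qed.

Lemma tr_expmx_gt0 n (H : 'M[R]_n) : (0 < n)%N -> H^T = H -> 0 < \tr (expmx H).
Proof.
case: n H => // n H _ /sym_spectral[Q [d HQ]]; rewrite (tr_expmx HQ).
by rewrite big_ord_recl ltr_pwDl ?expR_gt0 // sumr_ge0 // => i _; rewrite expR_ge0.
Qed.

(** Normalization becomes a scalar shift of the exponent, which gives the Gibbs state the explicit
    logarithm used by [klein] and [divergence_contraction]. *)
Lemma gibbsE n (H : 'M[R]_n) : (0 < n)%N -> H^T = H ->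
  gibbs H = expmx (H - (free_energy H)%:M).
Proof.
move=> n0 sH; have [Q [d HQ]] := sym_spectral sH.
have [_ ->] := spectral_expmx (spectral_shift (free_energy H) HQ).
rewrite /gibbs /normalize; have [_ {2}->] := spectral_expmx HQ.
rewrite scalemxAl scalemxAr; congr (_ *m _ *m _).
apply/matrixP => i j; rewrite !mxE expRD expRN /free_energy lnK.
  by case: eqP; rewrite ?mulr0 // mulr1n mulrC.
by rewrite posrE tr_expmx_gt0.
Qed.

Lemma tr_gibbs n (H : 'M[R]_n) : (0 < n)%N -> H^T = H -> \tr (gibbs H) = 1.
Proof. by move=> n0 sH; rewrite linearZ /= mulVf // gt_eqF // tr_expmx_gt0. Qed.

Lemma gibbs_psd n (H : 'M[R]_n) : (0 < n)%N -> H^T = H -> psd (gibbs H).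
Proof.
move=> n0 sH; rewrite gibbsE //; have [Q [d HQ]] := sym_spectral sH.
have PQ := spectral_expmx (spectral_shift (free_energy H) HQ).
apply/psdP; split; first exact: spectral_sym PQ.
move=> v; rewrite (spectral_form PQ) sumr_ge0 // => i _.
by rewrite mulr_ge0 ?sqr_ge0 // mxE expR_ge0.
Qed.

Lemma spectral0 n : spectral (0 : 'M[R]_n) 1%:M 0.
Proof.
by split; rewrite trmx1 !mulmx1 // mul1mx; apply/matrixP => i j; rewrite !mxE mul0rn.
Qed.

Lemma expmx0 n : expmx (0 : 'M[R]_n) = 1%:M.
Proof.
have [_ ->] := spectral_expmx (spectral0 n); rewrite trmx1 mulmx1 mul1mx.
by rewrite -diag_const_mx; congr diag_mx; apply/rowP => i; rewrite !mxE expR0.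
Qed.

Lemma free_energy0 n : free_energy (0 : 'M[R]_n) = ln n%:R.
Proof. by rewrite /free_energy expmx0 mxtrace1. Qed.

(* With L the logarithm of the Gibbs state, the increment of the free energy is
   linear up to a relative entropy, which is at most the symmetrized one. *)
Lemma free_energy_step n (H A : 'M[R]_n) (eta : R) :
  (0 < n)%N -> H^T = H -> A^T = A -> contraction A ->
  free_energy (H + eta *: (1%:M - A)) <=
    free_energy H + eta - eta * \tr (A *m gibbs H) + 2 * eta ^+ 2.
Proof.
move=> n0 sH sA cA; set H' := H + _.
have sH' : H'^T = H' by rewrite linearD linearZ /= linearB /= sH sA trmx1.
have [Q [d HQ]] := sym_spectral sH; have [U [d' HU]] := sym_spectral sH'.
have t1 := tr_gibbs n0 sH; have t1' := tr_gibbs n0 sH'.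
have eP := gibbsE n0 sH; have eP' := gibbsE n0 sH'.
set F := free_energy H in eP *; set F' := free_energy H' in eP' *.
set L := H - F%:M in eP; set L' := H' - F'%:M in eP'.
have LQ := spectral_shift F HQ; have LU := spectral_shift F' HU.
rewrite -/L in LQ; rewrite -/L' in LU.
have dL : L - L' = - eta *: (1%:M - A) + (F' - F)%:M.
  rewrite /L /L' /H' [(F' - F)%:M]raddfB /= scaleNr opprD opprK opprD !addrA.
  by rewrite (addrAC H) subrr add0r (addrC (- F%:M)) -!addrA (addrC (- F%:M)).
clearbody L L' F F' H'.
have trL (M : 'M[R]_n) : \tr (M *m (L - L')) =
    eta * \tr (M *m A) + (F' - F - eta) * \tr M.
  rewrite dL mulmxDr -scalemxAr mulmxBr mulmx1 mul_mx_scalar linearD /=.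
  rewrite !linearZ /= linearB /=; ring.
(* The difference of two Gibbs states has trace 0, so the scalar part of [L - L'] drops out and the
   self-bounding hypothesis of [divergence_contraction] holds. *)
have J : \tr ((gibbs H - gibbs H') *m (L - L')) <= 2 * eta ^+ 2.
  rewrite eP eP'; apply: (divergence_contraction LQ LU) cA _ => //; rewrite -?eP -?eP' //.
  by rewrite trL [\tr (_ - _)]linearB /= t1 t1' subrr mulr0 addr0.
have K : 0 <= \tr (gibbs H' *m (L' - L)).
  by rewrite eP'; apply: (klein LQ LU); rewrite -?eP -?eP'.
move: J; rewrite mulmxBl linearB /= trL t1 mulr1.
move: K; rewrite -opprB mulmxN linearN /= (mxtrace_mulC A); lra.
Qed.

(** In an eigenbasis of [H] the trace is an average of eigenvalues weighted by the diagonal of [X],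
    and no eigenvalue exceeds their log-sum-exp. This is the Gibbs variational bound with the
    entropy of [X] dropped. *)
Lemma tr_le_free_energy n (H X : 'M[R]_n) : (0 < n)%N -> H^T = H ->
  psd X -> \tr X = 1 -> \tr (H *m X) <= free_energy H.
Proof.
move=> n0 sH /psdP[_ pX] X1; have [Q [d HQ]] := sym_spectral sH.
have -> : free_energy H = \sum_i free_energy H * dotr (row i Q *m X) (row i Q).
  rewrite -mulr_sumr -[LHS]mulr1; congr (_ * _); rewrite -X1.
  have sQ : spectral 1%:M Q (const_mx 1).
    split; first by case: HQ.
    by rewrite diag_const_mx mulmx1 (spectral_trmxK HQ).
  by rewrite -[X in LHS]mul1mx (spectral_tr sQ); apply: eq_bigr => i _; rewrite mxE mul1r.
rewrite (spectral_tr HQ) ler_sum // => i _; rewrite ler_wpM2r //.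
rewrite -ler_expR lnK ?posrE ?tr_expmx_gt0 // (tr_expmx HQ) (bigD1 i) //= lerDl.
by rewrite sumr_ge0 // => j _; rewrite expR_ge0.
Qed.

End Gibbs.

(** * Correctness of Hamiltonian updates and of the binary search *)

Section HamiltonianUpdates.
Variable R : realType.
Set Implicit Arguments.
Unset Strict Implicit.

Lemma ceil_nat_ge (x : R) : x <= (ceil_nat x)%:R.
Proof.
rewrite /ceil_nat natr_absz ger0_norm ?le_max ?lexx //.
by rewrite (le_trans (Num.Theory.ceil_ge x)) // ler_int le_max lexx orbT.
Qed.

Section Rounds.
Variables (N M : nat) (eps : R) (A : 'I_M -> 'M[R]_N) (b : 'I_M -> R).
Hypotheses (N0 : (0 < N)%N) (eps0 : 0 < eps).
Hypothesis symA : forall j, (A j)^T = A j.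
Hypothesis cA : forall j, contraction (A j).

Let updE (S : 'M[R]_N) j : (eps / 4) *: (S + 2^-1 *: (1%:M - A j)) =
  (eps / 4) *: S + (eps / 8) *: (1%:M - A j).
Proof. by rewrite scalerDr scalerA; congr (_ + _ *: _); field. Qed.

Let symU (S : 'M[R]_N) j : S^T = S ->
  (S + 2^-1 *: (1%:M - A j))^T = S + 2^-1 *: (1%:M - A j).
Proof. by move=> sS; rewrite linearD linearZ /= linearB /= trmx1 sS symA. Qed.

Lemma HU_true_gibbs : HU eps A b true ->
  exists2 H : 'M[R]_N, H^T = H & forall j, \tr (A j *m gibbs H) <= b j + eps.
Proof.
(* Loop invariant: [W] is the exponential of [(eps / 4) *: S]. The answer [true] arises only from
   [HU_stop], whose normalized [W] is then a Gibbs state. *)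
suff gen q S W : S^T = S -> W = expmx ((eps / 4) *: S) ->
    HU_loop eps A b q S W true ->
    exists2 H : 'M[R]_N, H^T = H & forall j, \tr (A j *m gibbs H) <= b j + eps.
  by apply: gen; rewrite ?trmx0 // scaler0 expmx0.
move=> sS eW hu; move eb : true hu => eta hu; elim: hu sS eW eb => // {q S W eta}.
- move=> q S W h sS eW _; exists ((eps / 4) *: S); last by rewrite /gibbs -eW.
  by rewrite linearZ /= sS.
- move=> q S W j eta _ _ IH sS _ eb; apply: IH => //; exact: symU.
Qed.

(* The potential free_energy H - tr (H X), with H = (eps / 4) S, is nonnegative
   and drops by 3 eps^2 / 32 at every update. *)
Lemma HU_loop_false_bound (X : 'M[R]_N) (q : nat) (S W : 'M[R]_N) :
  psd X -> \tr X = 1 -> (forall j, \tr (A j *m X) <= b j) ->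
  S^T = S -> W = expmx ((eps / 4) *: S) ->
  HU_loop eps A b q S W false ->
  q%:R * (3 / 32 * eps ^+ 2) <=
    free_energy ((eps / 4) *: S) - \tr ((eps / 4) *: S *m X).
Proof.
move=> pX X1 hX sS eW hu; move eb : false hu => eta hu; elim: hu sS eW eb => //.
- move=> {}S {}W sS _ _; rewrite mul0r subr_ge0 tr_le_free_energy //.
  by rewrite linearZ /= sS.
- move=> {}q {}S {}W j {}eta hj _ IH sS eW eb.
  have := IH (symU j sS) erefl eb; rewrite updE => h.
  have sH : ((eps / 4) *: S)^T = (eps / 4) *: S by rewrite linearZ /= sS.
  have := free_energy_step (eps / 8) N0 sH (symA j) (cA j).
  have e : \tr (((eps / 4) *: S + (eps / 8) *: (1%:M - A j)) *m X) =
      \tr ((eps / 4) *: S *m X) + eps / 8 * (1 - \tr (A j *m X)).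
    rewrite mulmxDl linearD /=; congr (_ + _).
    by rewrite -scalemxAl linearZ /= mulmxBl mul1mx linearB /= X1.
  move: hj h; rewrite e eW -/(gibbs _) -natr1 mulrDl mul1r.
  have := hX j; set x := \tr (A j *m X); set p := \tr (A j *m gibbs _).
  set V := \tr (_ *m X); set F := free_energy _; set F' := free_energy _.
  (* The gain [eps / 8 * eps] from the violated constraint, minus the second-order loss
     [2 * (eps / 8) ^+ 2], leaves [3 / 32 * eps ^+ 2]. *)
  move=> h1 h2 h3 h4; have : eps / 8 * (p - x) >= eps / 8 * eps.
    by rewrite ler_pM2l ?divr_gt0 //; lra.
  move: h3 h4; rewrite expr2; lra.
Qed.

(** Over at least [16 * ln N / eps ^+ 2] rounds the potential would drop by [3 / 2 * ln N] or more,
    exceeding its initial value [ln N], which is positive since [1 < N]. *)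
Lemma HU_false_infeasible (X : 'M[R]_N) : (1 < N)%N ->
  psd X -> \tr X = 1 -> (forall j, \tr (A j *m X) <= b j) ->
  ~ HU eps A b false.
Proof.
move=> N1 pX X1 hX hu.
have := HU_loop_false_bound pX X1 hX (trmx0 _ _ _) _ hu.
rewrite scaler0 expmx0 mul0mx mxtrace0 subr0 free_energy0 => /(_ erefl).
have l0 : 0 < ln (N%:R : R) by rewrite ln_gt0 // ltr1n.
have := ceil_nat_ge (16 * ln N%:R / eps ^+ 2).
have e2 : 0 < eps ^+ 2 by rewrite exprn_gt0.
rewrite ler_pdivrMr //; lra.
Qed.

End Rounds.

(** Each answer preserves [lo <= lstar <= hi + delta]. The error [delta] sits on the upper end only,
    so it is counted once instead of accumulating over the halvings. *)
Lemma BS_loop_bracket (N M : nat) (C : 'M[R]_N) (A : 'I_M -> 'M[R]_N)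
    (b : 'I_M -> R) (eps lstar delta : R) (q : nat) (lo hi out : R) :
  (forall l, HU eps (fcons_last A C) (fcons_last b l) false -> l <= lstar) ->
  (forall l, HU eps (fcons_last A C) (fcons_last b l) true -> lstar <= l + delta) ->
  lo <= lstar <= hi + delta -> BS_loop C A b eps q lo hi out ->
  out <= lstar <= out + (hi - lo) / 2 ^+ q + delta.
Proof.
move=> hF hT + bs; elim: bs => {q lo hi out}.
- by move=> lo hi /andP[-> h] /=; rewrite expr0 divr1 addrCA subrr addr0.
- move=> q lo hi out /hF hm _ IH /andP[_ h].
  have := IH; rewrite hm h => /(_ isT) /andP[-> /= /le_trans]; apply.
  rewrite lerD2r lerD2l exprS invfM mulrA ler_wpM2r ?invr_ge0 ?exprn_ge0 //; lra.
- move=> q lo hi out /hT hm _ IH /andP[h _].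
  have := IH; rewrite hm h => /(_ isT) /andP[-> /= /le_trans]; apply.
  rewrite lerD2r lerD2l exprS invfM mulrA ler_wpM2r ?invr_ge0 ?exprn_ge0 //; lra.
Qed.

Lemma BS_INEQ_bracket (N M : nat) (C : 'M[R]_N) (A : 'I_M -> 'M[R]_N)
    (b : 'I_M -> R) (eps lstar delta lmin lmax out : R) :
  0 < eps -> lmin < lmax ->
  (forall l, HU eps (fcons_last A C) (fcons_last b l) false -> l <= lstar) ->
  (forall l, HU eps (fcons_last A C) (fcons_last b l) true -> lstar <= l + delta) ->
  lmin <= lstar <= lmax + delta -> BS_INEQ C A b lmin lmax eps out ->
  out <= lstar <= out + eps + delta.
Proof.
move=> e0 ll hF hT h /(BS_loop_bracket hF hT h) /andP[-> /= /le_trans]; apply.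
rewrite lerD2r lerD2l; set T := ceil_nat _.
have x0 : 0 < (lmax - lmin) / eps by rewrite divr_gt0 // subr_gt0.
have l2 : 0 < ln (2 : R) by rewrite ln_gt0 // ltr1n.
(* This also holds when the logarithm is negative: [ceil_nat] is then 0 and no iteration is run. *)
have : log2 ((lmax - lmin) / eps) <= T%:R by exact: ceil_nat_ge.
rewrite /log2 ler_pdivrMr // mulr_natl -lnXn // ler_ln ?posrE ?exprn_gt0 //.
by rewrite ler_pdivrMr // ler_pdivrMr ?exprn_gt0 // mulrC.
Qed.

End HamiltonianUpdates.

(** * Traces and quadratic forms of block-diagonal matrices *)

Section BlockDiagonal.
Variable R : realType.
Set Implicit Arguments.
Unset Strict Implicit.
Variables (p : nat) (p_ : 'I_p -> nat).

Lemma mxdiag_scale (a : R) (D : forall i, 'M[R]_(p_ i)) :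
  \mxdiag_i (a *: D i) = a *: \mxdiag_i D i.
Proof.
apply/matrixP => s t; rewrite !mxE; case: eqVneq => [e|_]; last by rewrite !mxE mulr0.
by move: (tagnat.sig2 s) (tagnat.sig2 t); rewrite e => x z; rewrite !conform_mx_id mxE.
Qed.

Lemma mxtrace_mul_mxdiag (D G : forall i, 'M[R]_(p_ i)) :
  \tr (\mxdiag_i D i *m \mxdiag_i G i) = \sum_i \tr (D i *m G i).
Proof.
rewrite [\mxdiag_i G i]/mxdiag mul_mxdiag_mxblock mxtrace_mxblock.
by apply: eq_bigr => i _; rewrite eqxx conform_mx_id.
Qed.

Lemma dotr_submxrow (u w : 'rV[R]_(\sum_i p_ i)) :
  dotr u w = \sum_i dotr (submxrow u i) (submxrow w i).
Proof.
rewrite /dotr -{1}[u]submxrowK -{1}[w]submxrowK tr_mxrow mul_mxrow_mxcol summxE.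
by [].
Qed.

Lemma dotr_mulmx_mxdiag (D : forall i, 'M[R]_(p_ i)) (u w : 'rV[R]_(\sum_i p_ i)) :
  dotr (u *m \mxdiag_i D i) w = \sum_i dotr (submxrow u i *m D i) (submxrow w i).
Proof.
rewrite dotr_submxrow; apply: eq_bigr => i _; congr dotr.
by rewrite -{1}[u]submxrowK mul_mxrow_mxdiag mxrowK.
Qed.

Lemma psd_mxdiag (D : forall i, 'M[R]_(p_ i)) :
  (forall i, psd (D i)) -> psd (\mxdiag_i D i).
Proof.
move=> pD; apply/psdP; split=> [|v].
  by rewrite tr_mxdiag; apply: eq_mxdiag => i; case: (pD i).
rewrite dotr_mulmx_mxdiag sumr_ge0 // => i _.
by have /psdP[_] := pD i; apply.
Qed.

Lemma contraction_mxdiag (D : forall i, 'M[R]_(p_ i)) :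
  (forall i, contraction (D i)) -> contraction (\mxdiag_i D i).
Proof.
move=> cD u w; rewrite dotr_mulmx_mxdiag mulr_sumr [dotr u u]dotr_submxrow.
rewrite [dotr w w]dotr_submxrow -big_split; apply: ler_sum => i _; exact: cD.
Qed.

End BlockDiagonal.

(** * The Riesz functional and localizing matrices *)

Section Riesz.
Variables (R : realType) (n : nat).
Set Implicit Arguments.
Unset Strict Implicit.
Implicit Types (p q g : {mpoly R[n]}) (y : multinom n -> R).

(** An index set independent of [p] allows sums for different polynomials to be combined. For
    nonzero [p], [mmeasure mdeg p] is the degree plus 1, matching the strict degree bound in
    [bmultinom n d]. *)
Lemma msupp_sum_bounded p d (F : multinom n -> R) : (mmeasure mdeg p <= d)%N ->
  \sum_(c <- msupp p) p@_c * F c = \sum_(c : bmultinom n d) p@_c * F c.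
Proof.
move=> pd; rewrite (big_mksub (bmultinom n d)) //=; first last.
- by move=> x /msize_mdeg_lt /leq_trans; apply.
- by rewrite msupp_uniq.
by rewrite big_rmcond //= => i; move/memN_msupp_eq0 ->; rewrite mul0r.
Qed.

Lemma rieszE y p d : (mmeasure mdeg p <= d)%N ->
  riesz y p = \sum_(c : bmultinom n d) p@_c * y c.
Proof. exact: msupp_sum_bounded. Qed.

Lemma rieszD y p q : riesz y (p + q) = riesz y p + riesz y q.
Proof.
pose d := maxn (mmeasure mdeg p) (mmeasure mdeg q).
rewrite !(@rieszE y _ d) ?leq_maxl ?leq_maxr ?mmeasureD_le // -big_split.
by apply: eq_bigr => c _; rewrite mcoeffD mulrDl.
Qed.

Lemma rieszZ y a p : riesz y (a *: p) = a * riesz y p.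
Proof.
rewrite !(@rieszE y _ (mmeasure mdeg p)) ?mmeasureZ_le // mulr_sumr.
by apply: eq_bigr => c _; rewrite mcoeffZ mulrA.
Qed.

Lemma riesz0 y : riesz y 0 = 0.
Proof. by rewrite -(scale0r 0) rieszZ mul0r. Qed.

Lemma riesz_sum y (I : Type) (s : seq I) (P : pred I) (F : I -> {mpoly R[n]}) :
  riesz y (\sum_(i <- s | P i) F i) = \sum_(i <- s | P i) riesz y (F i).
Proof. by apply: (big_morph (riesz y)); [exact: rieszD|exact: riesz0]. Qed.

Lemma rieszX y c : riesz y (mpolyX R c) = y c.
Proof. by rewrite /riesz msuppX big_seq1 mcoeffX eqxx mul1r. Qed.

Lemma rieszMX y p c :
  riesz y (p * mpolyX R c) = \sum_(z <- msupp p) p@_z * y (mnm_add c z).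
Proof.
rewrite {1}[p]mpolyE mulr_suml riesz_sum; apply: eq_bigr => z _.
by rewrite -scalerAl rieszZ -mpolyXD rieszX addmC.
Qed.

(** Lets identities proved for all sequences be read off coefficient by coefficient. *)
Lemma riesz_delta c p : riesz (fun z => (z == c)%:R) p = p@_c.
Proof.
rewrite [p in RHS]mpolyE linear_sum /=; apply: eq_bigr => z _.
by rewrite mcoeffZ mcoeffX.
Qed.

Lemma riesz_eval (x : 'I_n -> R) p : riesz (fun z => (mpolyX R z).@[x]) p = p.@[x].
Proof.
by rewrite [p in RHS]mpolyE linear_sum /=; apply: eq_bigr => z _; rewrite mevalZ.
Qed.

Lemma locmxE t g y i j :
  locmx t g y i j = riesz y (g * mpolyX R (mon i) * mpolyX R (mon j)).
Proof. by rewrite mxE -mulrA -mpolyXD rieszMX. Qed.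

Lemma momentmx_locmx t y : momentmx t y = locmx t 1 y.
Proof.
apply/matrixP => i j; rewrite locmxE mxE mul1r -mpolyXD rieszX.
by [].
Qed.

Lemma locmxC t g y i j : locmx t g y i j = locmx t g y j i.
Proof. by rewrite !locmxE mulrAC. Qed.

Lemma tr_locmx t g y : (locmx t g y)^T = locmx t g y.
Proof. by apply/matrixP => i j; rewrite mxE locmxC. Qed.

Lemma mon_ltn t (i : 'I_(nmon n t)) : (mdeg (mon i) <= t)%N.
Proof. exact: (bmdeg (enum_val i)). Qed.

Lemma sum_mon t (V : nmodType) (F : multinom n -> V) :
  \sum_(c : bmultinom n t.+1) F c = \sum_(i < nmon n t) F (mon i).
Proof.
rewrite (reindex (fun i : 'I_(nmon n t) => enum_val i)) //.
by apply: onW_bij; exact: enum_val_bij.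
Qed.

Lemma locmx_form t g y p : (mmeasure mdeg p <= t.+1)%N ->
  let v := \row_(i < nmon n t) p@_(mon i) in
  dotr (v *m locmx t g y) v = riesz y (g * p * p).
Proof.
move=> pt v.
have eq_p : p = \sum_(i < nmon n t) p@_(mon i) *: mpolyX R (mon i).
  by rewrite -(sum_mon t (fun c => p@_c *: mpolyX R c)) -mpolywE.
pose e := \sum_(i < nmon n t) p@_(mon i) *: mpolyX R (mon i).
have -> : g * p * p = g * e * e by rewrite /e -eq_p.
rewrite /e mulr_sumr riesz_sum dotr_mulmx tr_locmx dotrE; apply: eq_bigr => i _.
rewrite mulr_sumr mulr_suml riesz_sum [(v *m _) _ _]mxE mulr_sumr.
apply: eq_bigr => j _.
rewrite -[in RHS]scalerAr -[in RHS]scalerAr -[in RHS]scalerAl !rieszZ -locmxE.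
by rewrite [v _ i]mxE [v _ j]mxE.
Qed.

Lemma riesz_sqr_ge0 t g y p : psd (locmx t g y) -> (mmeasure mdeg p <= t.+1)%N ->
  0 <= riesz y (g * p * p).
Proof. by move=> /psdP[_ h] /locmx_form <-; exact: h. Qed.

(** At a point the localizing matrix is [g.@[x]] times the outer product of the monomial vector with
    itself. *)
Lemma psd_locmx_eval t g (x : 'I_n -> R) : 0 <= g.@[x] ->
  psd (locmx t g (fun z => (mpolyX R z).@[x])).
Proof.
move=> g0; apply/psdP; split; first exact: tr_locmx.
move=> v; pose s := \sum_i v ord0 i * (mpolyX R (mon i)).@[x].
suff -> : dotr (v *m locmx t g (fun z => (mpolyX R z).@[x])) v = g.@[x] * s ^+ 2.
  by rewrite mulr_ge0 // sqr_ge0.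
rewrite dotrE expr2 {2}/s mulrA mulr_sumr; apply: eq_bigr => j _.
rewrite mxE /s mulr_sumr mulr_suml [RHS]mulr_suml; apply: eq_bigr => i _.
by rewrite locmxE riesz_eval !mevalM; ring.
Qed.

Lemma riesz_gram t g y (G : 'M[R]_(nmon n t)) :
  riesz y (g * ((monvec R n t)^T *m map_mx (@mpolyC n R) G *m monvec R n t) ord0 ord0) =
  \tr (locmx t g y *m G).
Proof.
have -> : ((monvec R n t)^T *m map_mx (@mpolyC n R) G *m monvec R n t) ord0 ord0 =
    \sum_j \sum_i G i j *: (mpolyX R (mon i) * mpolyX R (mon j)).
  rewrite mxE; apply: eq_bigr => j _; rewrite mxE mulr_suml.
  apply: eq_bigr => i _; rewrite !mxE (mulrC (mpolyX R _)) -mulrA.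
  exact: mul_mpolyC.
rewrite mulr_sumr riesz_sum /mxtrace; apply: eq_bigr => j _.
rewrite [RHS]mxE mulr_sumr riesz_sum; apply: eq_bigr => i _.
by rewrite -scalerAr rieszZ mulrA -locmxE mulrC locmxC.
Qed.

End Riesz.

(** * Coefficient-matching matrices, the relaxed program and padding by a slack entry *)

Section Moments.
Variables (R : realType) (n : nat).
Set Implicit Arguments.
Unset Strict Implicit.
Implicit Types (p q : {mpoly R[n]}) (y : multinom n -> R).

Lemma mmeasure_halfdeg p h : (halfdeg p <= h)%N -> (mmeasure mdeg p <= (2 * h).+1)%N.
Proof. rewrite /halfdeg /mpdeg; lia. Qed.

Lemma sum_indicator_le1 (I : finType) (P : pred I) :
  (forall i j, P i -> P j -> i = j) -> \sum_i (P i)%:R <= 1 :> R.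
Proof.
move=> h; have [i Pi|P0] := pickP P.
  rewrite (bigD1 i) //= Pi big1 ?addr0 // => j ji.
  by apply/eqP; rewrite pnatr_eq0 eqb0; apply: contraNN ji => Pj; apply/eqP/h.
by rewrite big1 // => i _; rewrite P0.
Qed.

Lemma mon_inj t : injective (@mon n t).
Proof. by move=> i j ij; apply/enum_val_inj/val_inj. Qed.

(** Addition of monomials is cancellative, so each row and each column of [Bblock] holds at most one
    1; the AM-GM inequality is summed over these entries. *)
Lemma Bblock_bound t (eta : multinom n) (a : R) (u w : 'rV[R]_(nmon n t)) :
  2 * dotr (u *m (a *: Bblock R t eta)) w <= `|a| * (dotr u u + dotr w w).
Proof.
pose B (i j : 'I_(nmon n t)) : R := (mnm_add (mon i) (mon j) == eta)%:R.
have Bl (i : 'I_(nmon n t)) : \sum_j B i j <= 1.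
  apply: sum_indicator_le1 => j j' /eqP ej /eqP ej'.
  by apply: mon_inj; apply: (@addmI _ (mon i)); rewrite ej ej'.
have Br (j : 'I_(nmon n t)) : \sum_i B i j <= 1.
  apply: sum_indicator_le1 => i i' /eqP ej /eqP ej'.
  by apply: mon_inj; apply: (@addIm _ (mon j)); rewrite ej ej'.
have -> : dotr (u *m (a *: Bblock R t eta)) w =
    \sum_i \sum_j a * (B i j * (u ord0 i * w ord0 j)).
  rewrite dotrE exchange_big; apply: eq_bigr => j _.
  rewrite mxE mulr_suml; apply: eq_bigr => i _; rewrite !mxE -/(B i j); ring.
apply: (@le_trans _ _ (`|a| * \sum_i \sum_j B i j * (u ord0 i ^+ 2 + w ord0 j ^+ 2))).
  rewrite !mulr_sumr; apply: ler_sum => i _; rewrite !mulr_sumr; apply: ler_sum => j _.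
  have B0 : 0 <= B i j by rewrite ler0n.
  set x := u _ _; set z := w _ _.
  rewrite (_ : 2 * _ = B i j * (2 * (a * (x * z)))); last by ring.
  rewrite (mulrCA `|a|) ler_wpM2l // (le_trans (ler_norm _)) //.
  rewrite normrM ger0_norm // normrM normrM (mulrCA 2) ler_wpM2l //.
  rewrite -(real_normK (num_real x)) -(real_normK (num_real z)).
  have := sqr_ge0 (`|x| - `|z|); rewrite sqrrB; lra.
rewrite ler_wpM2l //; under eq_bigr do under eq_bigr do rewrite mulrDr.
under eq_bigr do rewrite big_split /=; rewrite big_split /= !dotrE lerD //.
  by apply: ler_sum => i _; rewrite -mulr_suml -expr2 ler_piMl ?sqr_ge0.
rewrite exchange_big; apply: ler_sum => i _.
by rewrite -mulr_suml -expr2 ler_piMl ?sqr_ge0.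
Qed.

Lemma l1norm_bounded p d : (mmeasure mdeg p <= d)%N ->
  l1norm p = \sum_(c : bmultinom n d) `|p@_c|.
Proof.
have e c : `|p@_c| = p@_c * Num.sg p@_c by rewrite mulrC -normrEsg.
move=> pd; rewrite /l1norm; under eq_bigr do rewrite e.
by under [RHS]eq_bigr do rewrite e; exact: msupp_sum_bounded.
Qed.

Section Relaxation.
Variables (m : nat) (g : 'I_m.+1 -> {mpoly R[n]}) (k : nat).
Hypothesis hk : forall i, (halfdeg (g i) <= k)%N.

(** In each entry, a monomial [z] of [g i] meets exactly one [c]: the sum of the row monomial, the
    column monomial and [z]. Its degree is at most [2 * k] because [halfdeg (g i) <= k]. *)
Lemma Dmx_sum y : Dmx g k y = \sum_(c : bmultinom n (2 * k).+1) y c *: Bmx g k c.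
Proof.
rewrite /Dmx; under [RHS]eq_bigr do rewrite -mxdiag_scale.
rewrite -mxdiag_sum.
apply: eq_mxdiag => i; apply/matrixP => a b.
rewrite mxE summxE (msupp_sum_bounded _ (mmeasure_halfdeg (leqnn _))).
set h := halfdeg (g i); set s := mnm_add (mon a) (mon b).
have s2 : (mdeg s <= 2 * (k - h))%N.
  by rewrite mdegD mul2n -addnn leq_add ?mon_ltn.
transitivity (\sum_(c : bmultinom n (2 * k).+1)
   \sum_(z : bmultinom n (2 * h).+1 | lem z c)
     (g i)@_z * (y c * (s == mnm_sub c z)%:R)); last first.
  apply: eq_bigr => c _; rewrite mxE summxE mulr_sumr; apply: eq_bigr => z _.
  by rewrite !mxE mulrCA.
under [RHS]eq_bigr do rewrite big_mkcond.
rewrite exchange_big; apply: eq_bigr => z _ /=.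
have sz : (mdeg (mnm_add s z) < (2 * k).+1)%N.
  by rewrite mdegD; have := bmdeg z; have := hk i; rewrite -/h; move: s2; lia.
rewrite (bigD1 (BMultinom sz)) //= lem_addl addmK eqxx mulr1 big1 ?addr0 // => c cs.
case: ifP => // zc; case: eqP => [e|]; last by rewrite !mulr0.
by case/eqP: cs; apply: val_inj; rewrite /= e submK.
Qed.

Lemma tr_Dmx y (X : 'M[R]_(bdim g k)) :
  \tr (Dmx g k y *m X) =
  \sum_(c : bmultinom n (2 * k).+1) y c * \tr (Bmx g k c *m X).
Proof.
rewrite Dmx_sum mulmx_suml linear_sum /=; apply: eq_bigr => c _.
by rewrite -scalemxAl linearZ.
Qed.

Lemma Bmx_Dmx c : (mdeg c <= 2 * k)%N ->
  Bmx g k c = Dmx g k (fun z => (z == c)%:R).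
Proof.
move=> ck; rewrite Dmx_sum (bigD1 (BMultinom (ck : (mdeg c < (2 * k).+1)%N))) //=.
rewrite eqxx scale1r big1 ?addr0 // => z zc.
rewrite (_ : (_ == _) = false) ?scale0r //.
by apply: contraNF zc => /eqP zc; apply/eqP/val_inj.
Qed.

Lemma Dmx_sym y : (Dmx g k y)^T = Dmx g k y.
Proof. by rewrite tr_mxdiag; apply: eq_mxdiag => i; exact: tr_locmx. Qed.

(** Polarized bounds add up: each block combines [Bblock] matrices with coefficients of total
    absolute value at most [l1norm (g i)]. *)
Lemma Bmx_contraction c : (forall i, l1norm (g i) <= 1) -> contraction (Bmx g k c).
Proof.
move=> g1; apply: contraction_mxdiag => i u w.
rewrite mulmx_sumr [dotr _ w]/dotr mulmx_suml summxE mulr_sumr.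
rewrite (le_trans (ler_sum _ (fun z _ => Bblock_bound _ _ u w))) //.
rewrite -mulr_suml ler_piMl ?addr_ge0 ?dotr_ge0 // (le_trans _ (g1 i)) //.
rewrite (l1norm_bounded (mmeasure_halfdeg (leqnn _))).
rewrite [leRHS](bigID (fun z : bmultinom _ _ => lem z c)) /=.
by rewrite lerDl sumr_ge0.
Qed.

Lemma riesz_sos y (G : forall i : 'I_m.+1, 'M[R]_(bsize g k i)) :
  riesz y (\sum_(i < m.+1) g i *
    ((monvec R n (k - halfdeg (g i)))^T *m map_mx (@mpolyC n R) (G i)
       *m monvec R n (k - halfdeg (g i))) ord0 ord0) =
  \tr (Dmx g k y *m \mxdiag_i G i).
Proof.
rewrite riesz_sum mxtrace_mul_mxdiag; apply: eq_bigr => i _; exact: riesz_gram.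
Qed.

(** Weak duality: the constraints are summed with the nonnegative weights [y c], and [tr_Dmx]
    reassembles the left-hand sides. *)
Lemma rel_feasible_riesz (f : {mpoly R[n]}) l (G : forall i : 'I_m.+1, 'M[R]_(bsize g k i)) y :
  (halfdeg f <= k)%N -> rel_feasible f l G ->
  (forall c : multinom n, (mdeg c <= 2 * k)%N -> 0 <= y c) ->
  \tr (Dmx g k y *m \mxdiag_i G i) <= riesz y f - l * y mnm0.
Proof.
move=> fk [_ G0 Gc] y0; rewrite tr_Dmx (rieszE _ (mmeasure_halfdeg fk)).
pose z0 : bmultinom n (2 * k).+1 := BMultinom (bm0_proof n (2 * k)).
rewrite (bigD1 z0) //= [in leRHS](bigD1 z0) //= addrAC -mulrBl lerD //.
  by rewrite mulrC ler_wpM2r // y0 // mdeg0.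
apply: ler_sum => c cz; have ck : (mdeg c <= 2 * k)%N := bmdeg c.
by rewrite mulrC ler_wpM2r ?y0 // Gc.
Qed.

(** Testing the polynomial identity on indicator sequences shows that all the trace constraints hold
    with equality. *)
Lemma sos_rel_feasible (f : {mpoly R[n]}) l (G : forall i : 'I_m.+1, 'M[R]_(bsize g k i)) :
  sos_feasible f l G -> rel_feasible f l G.
Proof.
move=> [pG e]; have coef c : (mdeg c <= 2 * k)%N ->
    (f - mpolyC n l)@_c = \tr (Bmx g k c *m \mxdiag_i G i).
  by move=> ck; rewrite (Bmx_Dmx ck) -riesz_sos -riesz_delta -e.
split=> // [|c ck c0]; first by rewrite -coef ?mdeg0 // mcoeffB mcoeffC eqxx mulr1.
by rewrite -coef // mcoeffB mcoeffC (negbTE c0) mulr0 subr0.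
Qed.

End Relaxation.

Lemma dotr0l N (u : 'rV[R]_N) : dotr 0 u = 0.
Proof. by rewrite /dotr mul0mx mxE. Qed.

Lemma dotr_row_mx n1 n2 (u1 w1 : 'rV[R]_n1) (u2 w2 : 'rV[R]_n2) :
  dotr (row_mx u1 u2) (row_mx w1 w2) = dotr u1 w1 + dotr u2 w2.
Proof. by rewrite /dotr tr_row_mx mul_row_col mxE. Qed.

Lemma pad0_contraction N (B : 'M[R]_N) : contraction B -> contraction (pad0 B).
Proof.
move=> cB u w; rewrite -[u]hsubmxK -[w]hsubmxK /pad0 mul_row_block.
rewrite !mulmx0 !addr0 !dotr_row_mx dotr0l.
have := cB (lsubmx u) (lsubmx w).
have := dotr_ge0 (rsubmx u); have := dotr_ge0 (rsubmx w); lra.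
Qed.

Lemma pad0_sym N (B : 'M[R]_N) : B^T = B -> (pad0 B)^T = pad0 B.
Proof. by move=> sB; rewrite /pad0 tr_block_mx sB !trmx0. Qed.

Lemma tr_pad0 N (B : 'M[R]_N) (X : 'M[R]_(N + 1)) :
  \tr (pad0 B *m X) = \tr (B *m ulsubmx X).
Proof.
rewrite -{1}[X]submxK /pad0 mulmx_block !mul0mx !addr0 mxtrace_block.
by rewrite mxtrace0 addr0.
Qed.

Lemma psd_ulsubmx N1 N2 (X : 'M[R]_(N1 + N2)) : psd X -> psd (ulsubmx X).
Proof.
move=> /psdP[sX pX]; apply/psdP; split=> [|v]; first by rewrite trmx_ulsub sX.
have := pX (row_mx v 0); rewrite -{1}[X]submxK mul_row_block !mul0mx !addr0.
by rewrite dotr_row_mx [dotr _ 0]dotrC dotr0l addr0.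
Qed.

Lemma psd_block_diag N (X : 'M[R]_N) (a : R) : psd X -> 0 <= a ->
  psd (block_mx X 0 0 (a%:M : 'M[R]_1)).
Proof.
move=> /psdP[sX pX] a0; apply/psdP; split=> [|v].
  by rewrite tr_block_mx sX !trmx0 tr_scalar_mx.
rewrite -[v]hsubmxK mul_row_block !mulmx0 addr0 add0r mul_mx_scalar.
by rewrite dotr_row_mx dotrZl addr_ge0 ?mulr_ge0 ?dotr_ge0.
Qed.

End Moments.

(** * The total mass of a dual feasible sequence *)

Section MassBound.
Variables (R : realType) (n : nat).
Set Implicit Arguments.
Unset Strict Implicit.
Implicit Types (y : multinom n -> R).

Let s : {mpoly R[n]} := \sum_(l < n) mpolyX R (mnm1 l).

Lemma mmeasure_powersum j : (mmeasure mdeg (s ^+ j) <= j.+1)%N.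
Proof.
have hs : s \is ishomog1 1 mdeg by apply: rpred_sum => l _; rewrite dhomogX /= mdeg1.
have hj : s ^+ j \is ishomog1 j mdeg by rewrite -[j in ishomog1 j]mul1n; exact: dhomogMn.
rewrite mmeasureE; apply/bigmax_leqP_seq => c cs _.
by rewrite (dhomog_mf hj).
Qed.

Lemma powersum_coef_ge0 j c : 0 <= (s ^+ j)@_c.
Proof.
elim: j c => [|j IH] c; first by rewrite expr0 mcoeff1 ler0n.
rewrite exprS mcoeffM sumr_ge0 // => d _; rewrite mulr_ge0 //.
by rewrite /s linear_sum sumr_ge0 // => l _; rewrite /= mcoeffX ler0n.
Qed.

(** These are multinomial coefficients. Induction peels off one variable dividing the monomial, the
    remaining terms being nonnegative, and so avoids the closed formula. *)
Lemma powersum_coef_ge1 j c : mdeg c = j -> 1 <= (s ^+ j)@_c.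
Proof.
elim: j c => [|j IH] c cj.
  by move/eqP: cj; rewrite mdeg_eq0 => /eqP ->; rewrite expr0 mcoeff1 eqxx.
have [l cl] : exists l, c l != 0%N.
  apply/existsP; rewrite -negb_forall; apply/negP => /forallP h.
  by move: cj; rewrite mdegE big1 // => i _; apply/eqP.
have e : c = mnm_add (mnm1 l) (mnm_sub c (mnm1 l)) by rewrite addmC submK // lep1mP.
rewrite e exprSr {2}/s (bigD1 l) //= mulrDr mcoeffD mcoeffMX.
apply: (@le_trans _ _ (s ^+ j)@_(mnm_sub c (mnm1 l))).
  by apply: IH; move: cj; rewrite {1}e mdegD mdeg1 add1n => -[].
rewrite lerDl mcoeffM sumr_ge0 // => d _; rewrite mulr_ge0 ?powersum_coef_ge0 //.
by rewrite linear_sum sumr_ge0 // => i _; rewrite /= mcoeffX ler0n.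
Qed.

Lemma mass_le_powersum k y :
  (forall c : multinom n, (mdeg c <= 2 * k)%N -> 0 <= y c) ->
  \sum_(c : bmultinom n (2 * k).+1) y c <= \sum_(j < (2 * k).+1) riesz y (s ^+ j).
Proof.
move=> y0; have -> : \sum_(c : bmultinom n (2 * k).+1) y c =
    \sum_(j < (2 * k).+1) \sum_(c : bmultinom n (2 * k).+1) (mdeg c == j)%:R * y c.
  rewrite exchange_big; apply: eq_bigr => c _; rewrite -mulr_suml.
  rewrite (bigD1 (Ordinal (bmdeg c))) //= eqxx big1 ?addr0 ?mul1r // => j jc.
  by rewrite (_ : (_ == _) = false) //; apply: contraNF jc => /eqP e; apply/eqP/val_inj.
apply: ler_sum => j _.
rewrite (@rieszE _ _ _ _ (2 * k).+1) ?(leq_trans (mmeasure_powersum j)) //.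
apply: ler_sum => c _; rewrite ler_wpM2r ?y0 //; first exact: (bmdeg c).
by case: eqP => [/powersum_coef_ge1|_] //; exact: powersum_coef_ge0.
Qed.

Lemma geometric_sum_le (r : R) N : 0 < r < 1 -> \sum_(j < N) r ^+ j <= 1 + r / (1 - r).
Proof.
move=> /andP[r0 r1]; have r1' : 0 < 1 - r by rewrite subr_gt0.
have -> : 1 + r / (1 - r) = 1 / (1 - r) by field; rewrite gt_eqF.
rewrite ler_pdivlMr //; have -> : (\sum_(j < N) r ^+ j) * (1 - r) = 1 - r ^+ N.
  by rewrite -[RHS]opprB subrX1 mulrC -mulNr opprB.
by rewrite lerBlDr lerDl exprn_ge0 // ltW.
Qed.

(** Testing the localizing condition for [r ^+ j - s ^+ j] on [s ^+ l] bounds the functional at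
    [s ^+ (l.*2 + j)] by [r ^+ j] times its value at [s ^+ l.*2]. Steps with [j = 2] climb the even
    powers, a last step with [j = 1] reaches an odd one, and the geometric series concludes. *)
Lemma dual_mass_bound m (g : 'I_m.+1 -> {mpoly R[n]}) k r y :
  0 < r < 1 ->
  (forall j : nat, (1 <= j <= 2)%N ->
    exists (i : 'I_m.+1) (c : R),
      [/\ (0 < i)%N, 0 < c & g i = c *: (mpolyC n (r ^+ j) - s ^+ j)]) ->
  dual_feasible g k y ->
  \sum_(c : bmultinom n (2 * k).+1) y c <= 1 + r / (1 - r).
Proof.
move=> r01 hg [y0 y1 _ yg]; have /andP[r0 _] := r01.
apply: (le_trans (mass_le_powersum y0)); apply: le_trans (geometric_sum_le _ r01).
have step j l : (1 <= j <= 2)%N -> (l < k)%N ->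
    riesz y (s ^+ (l.*2 + j)) <= r ^+ j * riesz y (s ^+ l.*2).
  move=> j12 lk; have [i [c [i0 c0 gi]]] := hg j j12.
  (* The bound 3 below is degree 2 plus 1. Half-degree at most 1 makes [s ^+ l] an admissible test
     polynomial for every [l < k]. *)
  have di : (halfdeg (g i) <= 1)%N.
    have : (mmeasure mdeg (g i) <= 3)%N.
      rewrite gi (leq_trans (mmeasureZ_le _ _ _)) // (leq_trans (mmeasureD_le _ _ _)) //.
      rewrite mmeasureN geq_max mmeasureC (leq_trans (leq_b1 _)) //=.
      by rewrite (leq_trans (mmeasure_powersum j)) //; case/andP: j12.
    rewrite /halfdeg /mpdeg; lia.
  have := riesz_sqr_ge0 (p := s ^+ l) (yg i i0).
  have lt : (mmeasure mdeg (s ^+ l) <= (k - halfdeg (g i)).+1)%N.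
    by rewrite (leq_trans (mmeasure_powersum l)) //; move: lk di; lia.
  have e : g i * s ^+ l * s ^+ l = c *: (r ^+ j *: s ^+ l.*2 + (-1) *: s ^+ (l.*2 + j)).
    rewrite gi -!scalerAl; congr (_ *: _).
    by rewrite scaleN1r -mul_mpolyC !mulrBl -!mulrA -!exprD addnn addnC.
  by move/(_ lt); rewrite e rieszZ pmulr_rge0 // rieszD !rieszZ mulN1r subr_ge0.
have even l : (l <= k)%N -> riesz y (s ^+ l.*2) <= r ^+ l.*2.
  elim: l => [|l IH] lk; first by rewrite !expr0 -mpolyX0 rieszX y1.
  rewrite doubleS -addn2 (le_trans (step 2 l _ _)) // [leRHS]exprD mulrC.
  by rewrite ler_wpM2r ?exprn_ge0 ?(ltW r0) // IH // ltnW.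
apply: ler_sum => -[j /= jk] _.
rewrite -(odd_double_half j) in jk *; case: odd jk => /= jk; last first.
  by rewrite add0n even //; move: jk; lia.
have jk' : (j./2 < k)%N by move: jk; lia.
rewrite addnC (le_trans (step 1 _ _ _)) // [leRHS]exprD mulrC.
by rewrite ler_wpM2r ?exprn_ge0 ?(ltW r0) // even // ltnW.
Qed.

End MassBound.

(** * Integrals of polynomials and moments of a measure *)

Section MeasureMoments.
Variables (R : realType) (n : nat).
Set Implicit Arguments.
Unset Strict Implicit.
Variable mu : {measure set (borelRn R n) -> \bar R}.
Hypothesis mom : finite_moments mu.

Lemma cvg_prodr T (F : set_system T) {FF : Filter F} (I : Type) (s : seq I)
    (f : I -> T -> R) (l : I -> R) :
  (forall i, f i @ F --> l i) ->
  (fun t => \prod_(i <- s) f i t) @ F --> \prod_(i <- s) l i.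
Proof.
move=> h; elim: s => [|i s IH].
  rewrite (_ : (fun t => _) = fun=> 1); last by apply/funext => t; rewrite big_nil.
  by rewrite big_nil; exact: cvg_cst.
rewrite (_ : (fun t => _) = fun t => f i t * \prod_(j <- s) f j t); last first.
  by apply/funext => t; rewrite big_cons.
by rewrite big_cons; apply: cvgM.
Qed.

Lemma continuous_meval (p : {mpoly R[n]}) : continuous (fun x : 'rV[R]_n => p.@[x ord0]).
Proof.
rewrite (_ : (fun x => _) = fun x : 'rV[R]_n =>
  \sum_(c <- msupp p) p@_c * \prod_i x ord0 i ^+ c i); last first.
  by apply/funext => z; rewrite mevalE.
move=> x; apply: cvg_sumr => c; apply: cvgM; first exact: cvg_cst.
apply: cvg_prodr => i.
apply: (@continuous_comp _ _ _ (fun z : 'rV[R]_n => z ord0 i) (fun t => t ^+ c i)).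
  exact: mx_coord_continuous.
exact: exprn_continuous.
Qed.

Lemma measurable_feasible_set m (g : 'I_m.+1 -> {mpoly R[n]}) :
  measurable (feasible_set g : set (borelRn R n)).
Proof.
rewrite -[feasible_set g]setCK; apply: measurableC; apply: sub_sigma_algebra.
apply/closed_openC.
have -> : feasible_set g = \bigcap_(i in [set i : 'I_m.+1 | (0 < i)%N])
    (fun x : 'rV[R]_n => (g i).@[x ord0]) @^-1` [set t | 0 <= t].
  by apply/seteqP; split => x /= h i; [move=> ?; exact: h|move=> ?; exact: h].
apply: closed_bigI => i _; apply: preimage_closed; last exact: closed_ge.
by move=> x _; exact: continuous_meval.
Qed.

Lemma integral_meval (p : {mpoly R[n]}) :
  \int[mu]_x p.@[(x : 'rV[R]_n) ord0] = riesz (moments mu) p.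
Proof.
rewrite /riesz; under eq_Rintegral do rewrite mevalE.
pose F (l : seq (multinom n)) (x : borelRn R n) : R := \sum_(c <- l) p@_c * monfun c x.
(* Linearity of the integral requires integrability of each partial sum, so the induction carries
   both facts. *)
suff [_ <-] : mu.-integrable setT (EFin \o F (msupp p)) /\
    \int[mu]_x F (msupp p) x = \sum_(c <- msupp p) p@_c * moments mu c.
  by apply: eq_Rintegral => x _; apply: eq_bigr => c _; rewrite /monfun mevalX.
elim: (msupp p) => [|c l [iF eF]].
  have F0 : F [::] = cst 0 by apply/funext => x; rewrite /F big_nil.
  rewrite F0 big_nil; split.
    by apply: (eq_integrable measurableT (cst 0%E)) => //; exact: integrable0.
  by rewrite Rintegral_cst ?mul0r.
have Fc : F (c :: l) = fun x => p@_c * monfun c x + F l x.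
  by apply/funext => x; rewrite /F big_cons.
have ic : mu.-integrable setT (EFin \o (fun x => p@_c * monfun c x)).
  apply: (eq_integrable _ (fun x => (p@_c)%:E * (EFin \o monfun c) x)%E) => //.
  by apply: integrableZl => //; exact: mom.
rewrite Fc; split; last by rewrite RintegralD // RintegralZl ?eF ?big_cons //; exact: mom.
exact: (integrableD measurableT ic iF).
Qed.

(** Up to a null set the integral runs over [S], where every monomial is nonnegative. *)
Lemma moments_ge0 (S : set (borelRn R n)) c :
  measurable S -> mu (~` S) = 0%E ->
  (forall x : 'rV[R]_n, S x -> forall l, 0 <= x ord0 l) -> 0 <= moments mu c.
Proof.
move=> mS mu0 Sp; rewrite /moments /Rintegral.
rewrite (negligible_integral (measurableC mS) measurableT (mom c) mu0).
rewrite fine_ge0 // integral_ge0 // => x [_ /= Sx]; rewrite lee_fin /monfun mevalX.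
by apply: prodr_ge0 => i _; rewrite exprn_ge0 // Sp //; exact: contrapT.
Qed.

End MeasureMoments.

(** * Comparison of the optimal values and meaning of the answers of HU *)

Section AlgorithmBounds.
Variables (R : realType) (n m k : nat) (f : {mpoly R[n]}).
Variable g : 'I_m.+1 -> {mpoly R[n]}.
Set Implicit Arguments.
Unset Strict Implicit.
Hypothesis g0 : g ord0 = 1.

Lemma halfdeg1 : halfdeg (1 : {mpoly R[n]}) = 0%N.
Proof. by rewrite /halfdeg /mpdeg mmeasure1. Qed.

Lemma l1norm1 : l1norm (1 : {mpoly R[n]}) = 1.
Proof. by rewrite /l1norm msupp1 big_seq1 mcoeff1 eqxx normr1. Qed.

Lemma bdim_gt0 : (0 < bdim g k)%N.
Proof.
rewrite /bdim (bigD1 ord0) //= ltn_addr // /bsize nmon_bin.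
by rewrite bin_gt0 leq_addr.
Qed.

Lemma dual_feasible_psd y : dual_feasible g k y -> psd (Dmx g k y).
Proof.
move=> [_ _ pm pl]; apply: psd_mxdiag => i.
have [->|i0] := eqVneq i ord0; last by apply: pl; rewrite lt0n.
change (psd (locmx (k - halfdeg (g ord0)) (g ord0) y)).
by rewrite g0 halfdeg1 subn0 -momentmx_locmx.
Qed.

(** The sequence consists of the moments of the Dirac measure at [x]. *)
Lemma eval_dual_feasible (x : 'rV[R]_n) :
  feasible_set g x -> (forall l, 0 <= x ord0 l) ->
  dual_feasible g k (fun z => (mpolyX R z).@[x ord0]).
Proof.
move=> gx x0; split.
- by move=> c _; rewrite mevalX prodr_ge0 // => i _; rewrite exprn_ge0.
- by rewrite mpolyX0 meval1.
- by rewrite momentmx_locmx; apply: psd_locmx_eval; rewrite meval1 ler01.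
- by move=> i i0; apply: psd_locmx_eval; exact: gx.
Qed.

Lemma tau_hat_le_eval (x : 'rV[R]_n) :
  feasible_set g x -> (forall l, 0 <= x ord0 l) -> (tau_hat f g k <= (f.@[x ord0])%:E)%E.
Proof.
move=> gx x0; apply: ereal_inf_lbound; exists (fun z => (mpolyX R z).@[x ord0]).
  exact: eval_dual_feasible.
by rewrite riesz_eval.
Qed.

Lemma lambda_sos_le_hat : (forall i, (halfdeg (g i) <= k)%N) ->
  (lambda_sos f g k <= lambda_hat f g k)%E.
Proof.
move=> gk; apply: ereal_sup_le => _ [l [G lG] <-]; exists l => //.
by exists G; exact: sos_rel_feasible.
Qed.

Section Constraints.
Variable gam : 'I_(ncon n k).+1 -> bmultinom n (2 * k).+1.
Hypotheses (bij_gam : bijective gam) (gam0 : bmnm (gam ord0) = mnm0).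

Definition con_mx : 'I_(ncon n k).+1 -> 'M[R]_(bdim g k + 1) :=
  fcons_last (fun i : 'I_(ncon n k) => pad0 (Bmx g k (gam (lift ord0 i))))
    (pad0 (Bmx g k mnm0)).

Definition con_rhs (l : R) : 'I_(ncon n k).+1 -> R :=
  fcons_last (fun i : 'I_(ncon n k) => f@_(gam (lift ord0 i))) l.

Lemma con_mxE j : exists2 c : multinom n, (mdeg c <= 2 * k)%N & con_mx j = pad0 (Bmx g k c).
Proof.
rewrite /con_mx /fcons_last; case: (unlift ord_max j) => [i|] /=.
  by exists (gam (lift ord0 i)) => //; exact: (bmdeg (gam (lift ord0 i))).
by exists mnm0; rewrite ?mdeg0.
Qed.

(** The slack [e] serves two uses: [e = 0] for an exactly feasible matrix, [e = eps] for the state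
    at which HU stops. *)
Lemma con_satisfied (X : 'M[R]_(bdim g k + 1)) (l e : R) :
  (forall j, \tr (con_mx j *m X) <= con_rhs l j + e) <->
  \tr (Bmx g k mnm0 *m ulsubmx X) <= l + e /\
  forall c : multinom n, (mdeg c <= 2 * k)%N -> c != mnm0 ->
    \tr (Bmx g k c *m ulsubmx X) <= f@_c + e.
Proof.
split=> [h|[h0 hc] j]; last first.
  rewrite /con_mx /con_rhs /fcons_last; case: (unlift ord_max j) => [i|] /=.
    rewrite tr_pad0; apply: hc; first exact: (bmdeg (gam (lift ord0 i))).
    apply/eqP => e0; have /(bij_inj bij_gam) : gam (lift ord0 i) = gam ord0.
      by apply: val_inj; rewrite /= e0 gam0.
    by move/eqP; rewrite eq_sym (negbTE (neq_lift _ _)).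
  by rewrite tr_pad0.
split=> [|c ck c0].
  by have := h ord_max; rewrite /con_mx /con_rhs /fcons_last unlift_none /= tr_pad0.
have [h' _ gK] := bij_gam.
pose z : bmultinom n (2 * k).+1 := BMultinom (ck : (mdeg c < (2 * k).+1)%N).
have := gK z.
case: (unliftP ord0 (h' z)) => [i ->|->] ec; last first.
  by move: c0; rewrite -gam0 ec eqxx.
have := h (lift ord_max i); rewrite /con_mx /con_rhs /fcons_last liftK /= tr_pad0.
by rewrite ec.
Qed.

Lemma con_mx_sym : (forall i, (halfdeg (g i) <= k)%N) -> forall j, (con_mx j)^T = con_mx j.
Proof.
by move=> gk j; have [c ck ->] := con_mxE j; rewrite pad0_sym // Bmx_Dmx // Dmx_sym.
Qed.

Lemma con_mx_contraction : (forall i, l1norm (g i) <= 1) -> forall j, contraction (con_mx j).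
Proof.
move=> g1 j; have [c ck ->] := con_mxE j; apply: pad0_contraction.
exact: Bmx_contraction.
Qed.

Lemma HU_false_bound (eps l lopt : R) (G : forall i : 'I_m.+1, 'M[R]_(bsize g k i)) :
  0 < eps -> (forall i, (halfdeg (g i) <= k)%N) -> (forall i, l1norm (g i) <= 1) ->
  rel_feasible f lopt G -> \tr (\mxdiag_i G i) <= 1 ->
  HU eps con_mx (con_rhs l) false -> l <= f@_mnm0 - lopt.
Proof.
move=> e0 gk g1 [pG G0 Gc] G1 hu; rewrite leNgt; apply/negP => ll; move: hu.
(* The slack entry supplies the missing trace and is invisible to constraints padded by zero. *)
pose X : 'M[R]_(bdim g k + 1) :=
  block_mx (\mxdiag_i G i) 0 0 ((1 - \tr (\mxdiag_i G i))%:M : 'M[R]_1).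
apply: (@HU_false_infeasible _ _ _ _ _ _ _ e0 _ _ X).
- by rewrite addn1.
- exact: con_mx_sym.
- exact: con_mx_contraction.
- by rewrite addn1 ltnS bdim_gt0.
- by apply: psd_block_diag; rewrite ?subr_ge0.
- by rewrite mxtrace_block mxtrace_scalar addrC subrK.
move=> j; rewrite -[con_rhs l j]addr0; move: j; apply/con_satisfied.
rewrite block_mxKul addr0; split; first exact: le_trans G0 (ltW ll).
by move=> c ck c0; rewrite addr0; exact: Gc.
Qed.

(** The Gibbs state has a nonnegative trace pairing with [Dmx g k y]; a violation of at most [eps]
    in the constraint at [c] enters with weight [y c], for a total of at most [eps * K]. *)
Lemma HU_true_bound (eps l : R) y (K : R) :
  0 < eps -> (halfdeg f <= k)%N -> (forall i, (halfdeg (g i) <= k)%N) ->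
  dual_feasible g k y -> \sum_(c : bmultinom n (2 * k).+1) y c <= K ->
  HU eps con_mx (con_rhs l) true -> f@_mnm0 - riesz y f <= l + eps * K.
Proof.
move=> e0 fk gk dy yK hu.
have N0 : (0 < bdim g k + 1)%N by rewrite addn1.
have [H sH /con_satisfied[P0 Pc]] := HU_true_gibbs (con_mx_sym gk) hu.
have pP := psd_ulsubmx (gibbs_psd N0 sH).
have := psd_tr_mulmx (dual_feasible_psd dy) pP; rewrite tr_Dmx //.
set P := ulsubmx _ in P0 Pc *; have [y0 y1 _ _] := dy.
rewrite (rieszE _ (mmeasure_halfdeg fk)).
pose z0 : bmultinom n (2 * k).+1 := BMultinom (bm0_proof n (2 * k)).
rewrite (bigD1 z0) //= [X in _ - X](bigD1 z0) //= y1 mul1r mulr1 => h.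
have h2 : \sum_(c : bmultinom n (2 * k).+1 | c != z0) y c * \tr (Bmx g k c *m P) <=
    \sum_(c : bmultinom n (2 * k).+1 | c != z0) f@_c * y c +
    eps * \sum_(c : bmultinom n (2 * k).+1 | c != z0) y c.
  rewrite mulr_sumr -big_split; apply: ler_sum => c cz /=.
  have ck : (mdeg c <= 2 * k)%N := bmdeg c.
  by rewrite -mulrDl mulrC ler_wpM2r ?y0 // Pc.
move: yK; rewrite (bigD1 z0) //= y1.
set S := \sum_(c : bmultinom n (2 * k).+1 | c != z0) y c in h2 *.
move=> yK; have := ler_wpM2l (ltW e0) yK; rewrite mulrDr mulr1; lra.
Qed.

End Constraints.

(** With [D = Dmx g k (moments mu)], the quantities [lambda_min D * \tr G], [\tr (D *m G)], [riesz
    (moments mu) f - l * moments mu mnm0], the integral of [f - lb], and [lambda_min D] form an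
    increasing chain; its third link uses [lb <= l]. *)
Lemma rel_feasible_tr_le1 (lb l : R) (mu : {measure set (borelRn R n) -> \bar R})
    (G : forall i : 'I_m.+1, 'M[R]_(bsize g k i)) :
  (halfdeg f <= k)%N -> (forall i, (halfdeg (g i) <= k)%N) ->
  (forall x, feasible_set g x -> forall l, 0 <= x ord0 l) ->
  mu (~` feasible_set g) = 0%E -> finite_moments mu ->
  0 < lambda_min (Dmx g k (moments mu)) ->
  (\int[mu]_x (f.@[(x : 'rV[R]_n) ord0] - lb))
    / lambda_min (Dmx g k (moments mu)) <= 1 ->
  rel_feasible f l G -> lb <= l -> \tr (\mxdiag_i G i) <= 1.
Proof.
move=> fk gk gpos mu0 mom lam0 mulb lG lbl.
have y0 c : 0 <= moments mu c.
  exact: (moments_ge0 mom c (measurable_feasible_set g) mu0 gpos).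
have [pG _ _] := lG.
have h1 := lambda_min_tr (Dmx_sym g k (moments mu)) pG.
have h2 := rel_feasible_riesz gk fk lG (fun c _ => y0 c).
have h3 : \int[mu]_x (f.@[(x : 'rV[R]_n) ord0] - lb) =
    riesz (moments mu) f - lb * moments mu mnm0.
  rewrite (_ : (\int[mu]_x _) = \int[mu]_x (f - lb *: 1).@[(x : 'rV[R]_n) ord0]).
    by rewrite integral_meval // -scaleNr rieszD rieszZ -mpolyX0 rieszX mulNr.
  by apply: eq_Rintegral => x _; rewrite mevalB mevalZ meval1 mulr1.
move: mulb; rewrite h3 ler_pdivrMr // mul1r => h4.
rewrite -(ler_pM2l lam0) mulr1 (le_trans h1) // (le_trans h2) // (le_trans _ h4) //.
by rewrite lerD2l lerN2 ler_wpM2r.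
Qed.

End AlgorithmBounds.

Theorem theorem6 (R : realType) (n m k : nat) (eps r : R)
    (f : {mpoly R[n]}) (g : 'I_m.+1 -> {mpoly R[n]})
    (lb : R) (mu : {measure set (borelRn R n) -> \bar R}) (a : 'rV[R]_n)
    (gam : 'I_(ncon n k).+1 -> bmultinom n (2 * k).+1) (lamhat_eps : R) :
  0 < eps ->
  g ord0 = 1 ->
  (maxn (halfdeg f) (\max_(i < m.+1) halfdeg (g i)) <= k)%N ->
  (forall x, feasible_set g x -> forall l, 0 <= x ord0 l) ->
  0 < r < 1 ->
  (forall j : nat, (1 <= j <= 2)%N ->
    exists (i : 'I_m.+1) (c : R),
      [/\ (0 < i)%N, 0 < c
        & g i = c *: (mpolyC n (r ^+ j) - (\sum_(l < n) mpolyX R (mnm1 l)) ^+ j)]) ->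
  (lb%:E <= lambda_sos f g k)%E ->
  mu (~` feasible_set g) = 0%E ->
  finite_moments mu ->
  0 < lambda_min (Dmx g k (moments mu)) ->
  (\int[mu]_x (f.@[(x : 'rV[R]_n) ord0] - lb))
    / lambda_min (Dmx g k (moments mu)) <= 1 ->
  (forall i : 'I_m.+1, (0 < i)%N -> l1norm (g i) <= 1) ->
  strong_duality f g k ->
  feasible_set g a ->
  f@_mnm0 - f.@[a ord0] < f@_mnm0 - lb ->
  bijective gam ->
  bmnm (gam ord0) = mnm0 ->
  CON_INEQ f g gam eps lb a lamhat_eps ->
  [/\ (lambda_sos f g k <= lambda_hat f g k)%E,
      (lambda_hat f g k <= fstar f g)%E
    & (0 <= lamhat_eps%:E - lambda_hat f g k
         <= (eps * (2 + r / (1 - r)))%:E)%E].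
Proof.
move=> e0 g0 hk gpos r01 hg lbl mu0 mom lam0 mulb g1 [lt [l [G [lG el]]] [y [dy ey]]].
move=> ga llt bij_gam gam0 [low bs ->].
move: hk; rewrite geq_max => /andP[fk /bigmax_leqP gk'].
have gk i : (halfdeg (g i) <= k)%N by exact: gk'.
have g1' i : l1norm (g i) <= 1.
  by have [->|i0] := eqVneq i ord0; [rewrite g0 l1norm1|rewrite g1 // lt0n].
have sl := lambda_sos_le_hat f gk.
have lbl' : lb <= l by rewrite -lee_fin el (le_trans lbl).
(* Strong duality gives the primal and dual optima a common value, so both answers of HU bracket the
   same threshold. *)
have yl : riesz y f = l by apply/EFin_inj; rewrite ey -lt -el.
have la : l <= f.@[a ord0].
  by rewrite -lee_fin el lt tau_hat_le_eval //; exact: gpos.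
have G1 := rel_feasible_tr_le1 fk gk gpos mu0 mom lam0 mulb lG lbl'.
have yK := dual_mass_bound r01 hg dy.
set K := 1 + r / (1 - r) in yK.
have K0 : 0 <= K.
  rewrite (le_trans _ yK) // sumr_ge0 // => c _.
  by case: dy => + _ _ _; apply; exact: (bmdeg c).
split=> //.
  rewrite lt; apply: le_ereal_inf_tmp => _ [x gx <-]; apply: tau_hat_le_eval => //.
  exact: gpos.
(* The threshold is [f@_mnm0 - l] and the one-sided error is [eps * K]; the initial interval is
   valid because [lb <= l <= f.@[a ord0]]. *)
have /andP[b1 b2] : low <= f@_mnm0 - l <= low + eps + eps * K.
  apply: (BS_INEQ_bracket e0 llt _ _ _ bs) => [l' hu|l' hu|].
  - exact: (HU_false_bound bij_gam gam0 e0 gk g1' lG G1 hu).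
  - by rewrite -yl; exact: (HU_true_bound g0 bij_gam gam0 e0 fk gk dy yK hu).
  - have := mulr_ge0 (ltW e0) K0; lra.
rewrite -el -EFinB !lee_fin; apply/andP; split; first by lra.
by move: b2; rewrite /K; set z := r / (1 - r); lra.
Qed.
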